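(* Let $\bar\varepsilon\in\mathcal{U}_e$ be given, and define on $\mathcal{E}_0$ the energetic functional $\mathcal{J}(e^* )=\frac12\langle L(\bar\varepsilon+e^* ):(\bar\varepsilon+e^* )\rangle$ and the geometric functional $\mathcal{N}(e^* )=\frac12\|\nabla\mathcal{J}(e^* )\|^2_{\mathcal{H}_e}=\frac12\|\Gamma_0L(\bar\varepsilon+e^* )\|^2_{\mathcal{H}_e}$. For any $e^*\in\mathcal{E}_0$, the vector $-\nabla\mathcal{N}(e^* )$ is a descent direction for the energetic functional $\mathcal{J}$ at $e^*$ and, reciprocally, $-\nabla\mathcal{J}(e^* )$ is a descent direction for the geometric functional $\mathcal{N}$ at $e^*$.
   Context: Let $\mathcal{V}\subset\mathbb{R}^d$ be a unit cell that tiles $\mathbb{R}^d$ by translation along a lattice $\mathcal{R}$ generated by $d$ vectors. ''Periodic'' means $\mathcal{R}$-periodic. $L^2_{\mathrm{per}}(\mathcal{V})$ is the space of periodic functions in $L^2_{\mathrm{loc}}(\mathbb{R}^d)$, and $H^1_{\mathrm{per}}(\mathcal{V})$ the space of periodic functions in $H^1_{\mathrm{loc}}(\mathbb{R}^d)$. All fields are real-valued. Write $\langle f\rangle=\frac1{|\mathcal{V}|}\int_{\mathcal{V}}f\,dx$ and $s:e=\sum_{i,j}s_{ij}e_{ij}$. $L_0$ is a uniform (constant in $x$) positive definite fourth-order tensor with major and minor symmetries; it acts on second-order tensors, $(L_0\eta)_{ij}=\sum_{k,l}(L_0)_{ijkl}\eta_{kl}$, and it is thus an invertible, symmetric positive definite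 linear map on symmetric $d\times d$ matrices. $L=L(x)$ is the periodic fourth-order elasticity tensor field of the composite, with major and minor symmetries, components in $L^\infty(\mathcal{V})$, and uniformly positive definite (there is $\mu>0$ with $L(x)e:e\ge\mu\, e:e$ for a.e. $x$ and all symmetric $e$); it acts pointwise, $(L\eta)(x)=L(x)\eta(x)$. $\mathcal{H}_e$ (strain fields) is the space of symmetric second-order tensor fields with components in $L^2_{\mathrm{per}}(\mathcal{V})$, with scalar product $(\eta,\tilde\eta)_{\mathcal{H}_e}=\langle L_0\eta:\tilde\eta\rangle$ and associated norm $\|\cdot\|_{\mathcal{H}_e}$. $\mathcal{H}_s$ (stress fields) is the same set of tensor fields, with scalar product $(\tau,\tilde\tau)_{\mathcal{H}_s}=\langle\tau:L_0^{-1}\tilde\tau\rangle$. $\mathcal{U}_e\subset\mathcal{H}_e$ is the subspace of uniform (constant) fields. $\mathcal{E}_0=\{e^*\in\mathcal{H}_e:\ \exists\,w^*\in H^1_{\mathrm{per}}(\mathcal{V})^d,\ e^*=\frac12(\nabla w^*+(\nabla w^* )^{\top})\}$. $\mathcal{S}$ is the space of $s\in\mathcal{H}_s$ such that $\operatorname{div}s=0$ in $\mathcal{V}$ and $s\cdot n$ is anti-periodic on $\partial\mathcal{V}$ ($n$ the unit outward normal), i.e. the periodic field $s$ is divergence-free on $\mathbb{R}^d$ in the sense of distributions. The strain Green's operator $\Gamma_0:\mathcal{H}_s\to\mathcal{H}_e$ associated with $L_0$ is defined by $\Gamma_0\tau=e^*$, where $e^*$ is the unique element of $\mathcal{E}_0$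 such that $L_0e^*-\tau\in\mathcal{S}$. For a functional $\mathcal{F}:\mathcal{E}_0\to\mathbb{R}$ (here $\mathcal{J}$ or $\mathcal{N}$), the gradient $\nabla\mathcal{F}(e^* )$ is the element of $\mathcal{E}_0$ such that $(\nabla\mathcal{F}(e^* ),\tilde e^* )_{\mathcal{H}_e}=\lim_{t\to0}\frac{\mathcal{F}(e^*+t\tilde e^* )-\mathcal{F}(e^* )}{t}$ for all $\tilde e^*\in\mathcal{E}_0$. A descent direction for $\mathcal{F}$ at $e^*$ is an element $p\in\mathcal{E}_0$ such that $(p,\nabla\mathcal{F}(e^* ))_{\mathcal{H}_e}<0$.
   Formalization: The descent claims are stated only at those e* where ∇J(e* ) is not zero in H_e; at a critical point of J (for instance ε̄ = 0, e* = 0) both scalar products vanish, so strict descent fails there. *)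

(* Defs.v *)
From HB Require Import structures.
From mathcomp Require Import all_boot all_order all_algebra.
From mathcomp Require Import all_classical all_reals all_analysis.

Set Implicit Arguments.
Unset Strict Implicit.
Unset Printing Implicit Defensive.

Import Order.TTheory GRing.Theory Num.Theory.
Import numFieldNormedType.Exports.

Local Open Scope classical_set_scope.
Local Open Scope ring_scope.

(* The sigma-algebra on R^n generated by the coordinates, i.e. the product
   sigma-algebra; it coincides with the Borel sigma-algebra. *)
Section measurable_rV.
Context {R : realType} {n : nat}.

Definition rV_coord (i : 'I_n) (x : 'rV[R]_n) : R := x ord0 i.

Let rV_set0 : g_sigma_preimage rV_coord set0.
Proof. exact: sigma_algebra0. Qed.

Let rV_setC A : g_sigma_preimage rV_coord A -> g_sigma_preimage rV_coord (~` A).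
Proof. exact: sigma_algebraC. Qed.

Let rV_bigcup (F : _^nat) : (forall i, g_sigma_preimage rV_coord (F i)) ->
  g_sigma_preimage rV_coord (\bigcup_i (F i)).
Proof. exact: sigma_algebra_bigcup. Qed.

HB.instance Definition _ :=
  @isMeasurable.Build (measure_tuple_display default_measure_display)
  'rV[R]_n (g_sigma_preimage rV_coord) rV_set0 rV_setC rV_bigcup.

Lemma measurable_rV_coord (i : 'I_n) : measurable_fun setT (rV_coord i).
Proof.
move=> _ Y mY; rewrite setTI; apply: sub_sigma_algebra => /=.
rewrite -bigcup_seq/=; exists i => /=; first by rewrite mem_index_enum.
by exists Y => //; rewrite setTI.
Qed.

Lemma measurable_fun_rVP d (T : measurableType d) (f : T -> 'rV[R]_n) :
  (forall i, measurable_fun setT (rV_coord i \o f)) -> measurable_fun setT f.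
Proof.
move=> mf _ B mB; rewrite setTI.
pose G : set (set 'rV[R]_n) := [set B | measurable (f @^-1` B)].
suff : @measurable _ 'rV[R]_n `<=` G by apply.
apply: smallest_sub.
  split => [|A GA|F GF].
  - by rewrite /G/= preimage_set0.
  - by rewrite /G/= setTD -preimage_setC; exact: measurableC.
  - by rewrite /G/= preimage_bigcup; exact: bigcupT_measurable.
rewrite -bigcup_seq => A/= [i _ [C mC <-]]; rewrite /G/= setTI.
by have := mf i measurableT C mC; rewrite setTI.
Qed.

End measurable_rV.

Section lebesgue_rV.
Context {R : realType}.

Definition rV_cons n (p : measurableTypeR R * 'rV[R]_n) : 'rV[R]_n.+1 :=
  \row_i (if unlift ord0 i is Some j then p.2 ord0 j else p.1).

Lemma measurable_rV_cons n : measurable_fun setT (@rV_cons n).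
Proof.
apply: (measurable_fun_rVP (T := (measurableTypeR R * 'rV[R]_n)%type)) => i.
case: (unliftP ord0 i) => [j ->|->].
  rewrite (_ : _ \o _ = rV_coord j \o snd); last first.
    by apply/funext => p /=; rewrite /rV_coord mxE liftK.
  by apply: measurableT_comp => //; exact: measurable_rV_coord.
rewrite (_ : _ \o _ = (fst : measurableTypeR R * 'rV[R]_n -> R)) //.
by apply/funext => p /=; rewrite /rV_coord mxE unlift_none.
Qed.

(* n-dimensional Lebesgue measure, as the iterated product of the
   one-dimensional one; [lebesgue_rV_box] is the usual characterization. *)
Fixpoint lebesgue_rV (n : nat) : set 'rV[R]_n -> \bar R :=
  match n with
  | 0 => \d_(0 : 'rV[R]_0)
  | m.+1 => pushforward (lebesgue_measure \x lebesgue_rV (n := m))%E (@rV_cons m)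
  end.

Definition rV_uncons n (x : 'rV[R]_n.+1) : measurableTypeR R * 'rV[R]_n :=
  (x ord0 ord0, \row_j x ord0 (lift ord0 j)).

Lemma rV_consK n : cancel (@rV_cons n) (@rV_uncons n).
Proof.
move=> [a v]; rewrite /rV_uncons /rV_cons mxE unlift_none; congr (_, _).
by apply/rowP => j; rewrite !mxE liftK.
Qed.

Lemma rV_unconsK n : cancel (@rV_uncons n) (@rV_cons n).
Proof.
move=> x; apply/rowP => i; rewrite mxE /=.
by case: unliftP => [j ->|->]; rewrite ?mxE.
Qed.

Lemma measurable_rV_uncons n : measurable_fun setT (@rV_uncons n).
Proof.
apply/measurable_fun_pairP; split; first exact: (measurable_rV_coord ord0).
apply: measurable_fun_rVP => i.
rewrite (_ : _ \o _ = rV_coord (lift ord0 i)); last first.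
  by apply/funext => x /=; rewrite /rV_coord mxE.
exact: measurable_rV_coord.
Qed.

Lemma lebesgue_rV_sigma_finite_measure n :
  exists m : {sigma_finite_measure set 'rV[R]_n -> \bar R},
    lebesgue_rV (n := n) = m.
Proof.
elim: n => [|n [m mE]]; first by exists (\d_(0 : 'rV[R]_0)).
pose l : {sigma_finite_measure set (measurableTypeR R) -> \bar R} :=
  @lebesgue_measure R.
pose p : {measure set (measurableTypeR R * 'rV[R]_n)%type -> \bar R} := (l \x m)%E.
pose q : {measure set 'rV[R]_n.+1 -> \bar R} :=
  measure_function_pushforward__canonical__measure_function_Measure
    p (@measurable_rV_cons n).
have qs : sigma_finite setT q.
  have /sigma_finiteP[F [FT ndF Foo]] := sigma_finiteT l.
  have /sigma_finiteP[G [GT ndG Goo]] := sigma_finiteT m.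
  exists (fun k => @rV_uncons n @^-1` (F k `*` G k)).
    rewrite -preimage_bigcup (_ : \bigcup_k _ = setT) ?preimage_setT//.
    rewrite -subTset => -[x y] _.
    have [i _ Fx] : (\bigcup_i F i) x by rewrite -FT.
    have [j _ Gy] : (\bigcup_i G i) y by rewrite -GT.
    exists (maxn i j) => //; split => /=.
      by move: x Fx; exact/subsetPset/ndF/leq_maxl.
    by move: y Gy; exact/subsetPset/ndG/leq_maxr.
  move=> k; have [mF lF] := Foo k; have [mG mGoo] := Goo k; split.
    rewrite -[X in measurable X]setTI; apply: measurable_rV_uncons => //.
    exact: measurableX.
  rewrite /q/= /pushforward -comp_preimage.
  rewrite (_ : _ \o _ = idfun) ?preimage_id; last exact/funext/rV_consK.
  by rewrite /p/= product_measure1E// lte_mul_pinfty// ge0_fin_numE.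
pose qS := Measure_isSigmaFinite.Build _ _ _ q qs.
pose r : {sigma_finite_measure set 'rV[R]_n.+1 -> \bar R} :=
  HB.pack (Measure.sort q) (Measure.class q) qS.
by exists r; rewrite /= mE.
Qed.

Let lebesgue_rV0 n : lebesgue_rV (n := n) set0 = 0%E.
Proof. by have [m ->] := lebesgue_rV_sigma_finite_measure n; rewrite measure0. Qed.

Let lebesgue_rV_ge0 n A : (0 <= lebesgue_rV (n := n) A)%E.
Proof. by have [m ->] := lebesgue_rV_sigma_finite_measure n. Qed.

Let lebesgue_rV_sigma_additive n : semi_sigma_additive (lebesgue_rV (n := n)).
Proof.
have [m ->] := lebesgue_rV_sigma_finite_measure n.
exact: measure_semi_sigma_additive.
Qed.

HB.instance Definition _ n := isMeasure.Build _ _ _ (lebesgue_rV (n := n))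
  (lebesgue_rV0 n) (@lebesgue_rV_ge0 n) (@lebesgue_rV_sigma_additive n).

Let lebesgue_rV_sigma_finite n : sigma_finite setT (lebesgue_rV (n := n)).
Proof.
have [m ->] := lebesgue_rV_sigma_finite_measure n.
exact: sigma_finiteT.
Qed.

HB.instance Definition _ n := Measure_isSigmaFinite.Build _ _ _
  (lebesgue_rV (n := n)) (lebesgue_rV_sigma_finite n).

Lemma measurable_rV_box n (A : 'I_n -> set R) :
  (forall i, measurable (A i)) ->
  measurable [set x : 'rV[R]_n | forall i, A i (x ord0 i)].
Proof.
move=> mA.
rewrite (_ : mkset _ = \big[setI/setT]_(i < n) (rV_coord i @^-1` A i)).
  apply: bigsetI_measurable => i _; rewrite -[X in measurable X]setTI.
  exact: measurable_rV_coord.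
rewrite -bigcap_seq; apply/seteqP; split=> x /= xA i; first by move=> _; exact: xA.
exact/xA/mem_index_enum.
Qed.

Lemma lebesgue_rV_box n (A : 'I_n -> set R) :
  (forall i, measurable (A i)) ->
  lebesgue_rV [set x : 'rV[R]_n | forall i, A i (x ord0 i)] =
  (\prod_(i < n) lebesgue_measure (A i))%E.
Proof.
elim: n A => [|n IH] A mA.
  by rewrite big_ord0 /= diracE mem_set// => -[].
rewrite big_ord_recl -IH// /= /pushforward.
have [m mE] := lebesgue_rV_sigma_finite_measure n.
rewrite (_ : _ @^-1` _ = A ord0 `*`
    [set x : 'rV[R]_n | forall i, A (lift ord0 i) (x ord0 i)]).
  rewrite mE product_measure1E//; [exact: (mA ord0)|].
  by apply: (@measurable_rV_box _ (fun i : 'I_n => A (lift ord0 i))) => i; exact: mA.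
apply/seteqP; split=> [[a v]/= Av|[a v]/= [Aa Av] i].
  split=> [|i]; first by have := Av ord0; rewrite mxE unlift_none.
  by have := Av (lift ord0 i); rewrite mxE liftK.
by rewrite mxE; case: unliftP => [j ->|->].
Qed.

End lebesgue_rV.

Section tensors.
Context {R : realType} {d : nat}.

Definition ddot (s e : 'M[R]_d) : R := \sum_i \sum_j s i j * e i j.

Definition tensor4 := 'I_d -> 'I_d -> 'I_d -> 'I_d -> R.

Definition tapp (C : tensor4) (e : 'M[R]_d) : 'M[R]_d :=
  \matrix_(i, j) \sum_k \sum_l C i j k l * e k l.

Definition major_symmetric (C : tensor4) := forall i j k l, C i j k l = C k l i j.

Definition minor_symmetric (C : tensor4) :=
  forall i j k l, C i j k l = C j i k l /\ C i j k l = C i j l k.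

Definition symmetric_mx (e : 'M[R]_d) := e^T = e.

Definition reference_tensor (C : tensor4) :=
  [/\ major_symmetric C, minor_symmetric C &
      forall e, symmetric_mx e -> e != 0 -> 0 < ddot (tapp C e) e].

End tensors.
Arguments tensor4 : clear implicits.

Section sobolev.
Context {R : realType} {d : nat}.
Local Notation X := 'rV[R]_d.
Local Notation mu := (lebesgue_rV (R := R) (n := d)).

Definition partial (i : 'I_d) (f : X -> R) : X -> R :=
  fun x => 'D_(delta_mx ord0 i) f x.

Fixpoint Ck (k : nat) (f : X -> R) : Prop :=
  match k with
  | 0 => continuous f
  | m.+1 => continuous f /\
      forall i, (forall x, derivable f x (delta_mx ord0 i)) /\ Ck m (partial i f)
  end.

Definition test_function (f : X -> R) :=
  (forall k, Ck k f) /\ compact (closure [set x | f x != 0]).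

(* `|x| is the sup norm on R^d, so the domains of integration are the closed
   cubes centred at 0, which are cofinal among the compact sets. *)
Definition L2loc (f : X -> R) :=
  measurable_fun setT f /\
  forall r : R,
    (\int[mu]_(x in [set x : X | (`|x| <= r)%R]) ((f x) ^+ 2)%:E < +oo)%E.

Definition weak_partial (i : 'I_d) (w g : X -> R) :=
  forall f, test_function f ->
    \int[mu]_x (w x * partial i f x) = - \int[mu]_x (g x * f x).

Definition H1loc (w : X -> R) :=
  L2loc w /\ forall i, exists2 g, L2loc g & weak_partial i w g.

End sobolev.

Section periodic_fields.
Context {R : realType} {d : nat}.
Local Notation X := 'rV[R]_d.
Local Notation mu := (lebesgue_rV (R := R) (n := d)).
Local Notation field := (X -> 'M[R]_d).

(* The lattice generated by the rows of [A]. *)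
Definition lattice (A : 'M[R]_d) : set X :=
  [set r | exists z : 'rV[int]_d, r = map_mx (fun m : int => m%:~R) z *m A].

(* The translates of [V] cover the space and do not overlap, up to null sets,
   so that a cell may or may not contain its boundary. *)
Definition unit_cell (A : 'M[R]_d) (V : set X) :=
  [/\ measurable V,
      (forall r, lattice A r -> r != 0 ->
         mu (V `&` [set x + r | x in V]) = 0%E) &
      {ae mu, forall x, exists2 r, lattice A r & V (x - r)}].

Definition lattice_periodic (A : 'M[R]_d) (T : Type) (f : X -> T) :=
  forall r, lattice A r -> forall x, f (x + r) = f x.

Definition L2per A (f : X -> R) := L2loc f /\ lattice_periodic A f.
Definition H1per A (f : X -> R) := H1loc f /\ lattice_periodic A f.

Definition avg (V : set X) (f : X -> R) : R :=
  (fine (mu V))^-1 * \int[mu]_(x in V) f x.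

(* The common underlying space of the strain and of the stress fields.  Fields
   are represented by functions, two of which stand for the same element when
   they are equal almost everywhere. *)
Definition tensor_field (A : 'M[R]_d) (e : field) :=
  (forall x, symmetric_mx (e x)) /\
  lattice_periodic A e /\ forall i j, L2loc (fun x => e x i j).

Definition ae_zero (e : field) := {ae mu, forall x, e x = 0}.

Definition apply_tensor (L : X -> tensor4 R d) (e : field) : field :=
  fun x => tapp (L x) (e x).

Definition elasticity_field (A : 'M[R]_d) (L : X -> tensor4 R d) :=
  [/\ forall x, major_symmetric (L x) /\ minor_symmetric (L x),
      lattice_periodic A L,
      forall i j k l, measurable_fun setT (fun x => L x i j k l) /\
        exists M, {ae mu, forall x, `|L x i j k l| <= M} &
      exists2 c, 0 < c & {ae mu, forall x, forall e,
        symmetric_mx e -> c * ddot e e <= ddot (tapp (L x) e) e}].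

Definition inner_e (V : set X) (L0 : tensor4 R d) (e e' : field) : R :=
  avg V (fun x => ddot (apply_tensor (cst L0) e x) (e' x)).

Definition norm_e V L0 (e : field) : R := Num.sqrt (inner_e V L0 e e).

Definition uniform_field (e : field) :=
  exists2 E, symmetric_mx E & e = cst E.

(* [Dw x i j] is the weak derivative of the i-th component of [w] in the j-th
   direction. *)
Definition compatible (A : 'M[R]_d) (e : field) :=
  tensor_field A e /\
  exists (w : X -> 'rV[R]_d) (Dw : field),
    [/\ forall i, H1per A (fun x => w x ord0 i),
        forall i j, L2loc (fun x => Dw x i j) /\
          weak_partial j (fun x => w x ord0 i) (fun x => Dw x i j) &
        {ae mu, forall x, e x = 2^-1 *: (Dw x + (Dw x)^T)}].

Definition div_free (s : field) :=
  forall i f, test_function f ->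
    \int[mu]_x (\sum_j s x i j * partial j f x) = 0.

Definition self_equilibrated (A : 'M[R]_d) (s : field) :=
  tensor_field A s /\ div_free s.

(* The two conditions determine [G t] up to equality almost everywhere, so that
   uniqueness is not part of the definition. *)
Definition strain_green (A : 'M[R]_d) (L0 : tensor4 R d) (G : field -> field) :=
  forall t, tensor_field A t ->
    compatible A (G t) /\ self_equilibrated A (apply_tensor (cst L0) (G t) - t).

Definition is_gradient A V L0 (F : field -> R) (e g : field) :=
  compatible A g /\
  forall h, compatible A h ->
    (F (e + t *: h) - F e) / t @[t --> (0 : R)^'] --> inner_e V L0 g h.

(* A representative of the gradient, which is unique up to equality almost
   everywhere; 0 when there is no gradient. *)
Definition gradient A V L0 (F : field -> R) (e : field) : field :=
  xget 0 [set g | is_gradient A V L0 F e g].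

Definition descent_direction A V L0 (F : field -> R) (e p : field) :=
  compatible A p /\ inner_e V L0 p (gradient A V L0 F e) < 0.

Definition energetic_functional V (L : X -> tensor4 R d) (ebar e : field) : R :=
  2^-1 * avg V (fun x => ddot (apply_tensor L (ebar + e) x) ((ebar + e) x)).

Definition geometric_functional A V L0 L (ebar e : field) : R :=
  2^-1 * norm_e V L0 (gradient A V L0 (energetic_functional V L ebar) e) ^+ 2.

End periodic_fields.

(* Main.v *)
Require Import Defs.
From mathcomp Require Import all_boot all_order all_algebra.
From mathcomp Require Import all_classical all_reals all_analysis.
From mathcomp Require Import measurable_realfun ring lra.
Import Order.TTheory GRing.Theory Num.Theory.
Import numFieldNormedType.Exports.
Set Implicit Arguments.
Unset Strict Implicit.
Unset Printing Implicit Defensive.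
Local Open Scope classical_set_scope.
Local Open Scope ring_scope.

(** Both descent properties say that the two gradients have a positive scalar
    product.  Write [<s : e>] for the cell average of [ddot s e] and
    [(e, h)] for the scalar product of strains.  Since [J] is quadratic and [L]
    has the major symmetry, the derivative of [J] at [e] in the direction [h]
    is [<L (ebar + e) : h>].  The Green operator represents such linear forms:
    [(Gamma0 t, h) = <t : h>] for every compatible [h]
    ([strain_green_dual]).  So [Gamma0 (L (ebar + e))] is a gradient of [J],
    and [N] is half the squared norm of a field that depends affinely on [e].
    Its derivative in the direction [h] is [<L h : grad J e>], that is
    [<L (grad J e) : h>], so [Gamma0 (L (grad J e))] is a gradient of [N].
    Hence
      [(grad N e, grad J e) = <L (grad J e) : grad J e>],
    which is positive by coercivity of [L] unless [grad J e] vanishes almost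
    everywhere ([elastic_energy_gt0]).  Gradients are only determined almost
    everywhere, so that all identities between them are tested against
    compatible fields.

    The analytic content is the duality of [Gamma0], which is the Hill-Mandel
    lemma ([hill_mandel]): a divergence-free periodic stress [s] and a
    compatible periodic strain [h] satisfy [<s : h> = 0].  Both
    conditions are tested against smooth compactly supported functions on the
    whole space, whereas the average is over one cell.  The two are connected
    by the correlation
      [g y = <s : h (. + y)>].
    Integrated against a test function [f], it becomes by Fubini an average of
    [s x] against the mean of [h (x + .)] with weight [f].  As [s x] is
    symmetric, the strain may be replaced by the weak gradient of the displacement [w], and
    the derivative then moves onto [f]; a second use of Fubini and a periodic
    translation put the derivatives of [f] against [s], where they vanish.
    So [g] integrates to zero against all test functions
    ([weak_strain_integral], [div_free_correlation]).  Since [g] is continuous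
    at [0] ([correlation_continuous]), concentrating bumps at [0] gives
    [g 0 = 0] ([mollifier_eq0]).  Only the strain, and not the weak gradient
    itself, is known to be periodic, which is why the symmetrization has to
    take place before the correlations are formed.

    What remains is real analysis on row vectors.  Lebesgue measure is
    invariant under reflections, hence under translations, because the product
    formula on rectangles is.  The integral of a periodic function over a cell
    is independent of the cell, by Tonelli over the lattice
    ([ge0_integral_packing_covering]); comparison with a large cube shows that
    a cell, even an unbounded one, has finite measure and that locally square
    integrable periodic functions are square integrable on it.  Translations
    are continuous in the mean square ([L2loc_translation_continuous]), by a
    pi-lambda argument that starts from open rectangles.  Bumps are built from
    the functions [t ^ - n * exp (- 1 / t)], whose span is stable under
    differentiation. *)

(** * Rectangles and reflections *)

Section rectangles.
Context {R : realType} {n : nat}.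
Local Notation X := 'rV[R]_n.
Local Notation mu := (lebesgue_rV (R := R) (n := n)).

Definition rectangle (B : 'I_n -> set R) : set X :=
  [set x | forall i, B i (x ord0 i)].

Definition open_rectangles : set (set X) :=
  [set C | exists2 B : 'I_n -> set R, (forall i, open (B i)) & C = rectangle B].

Lemma open_rectangles_setI : setI_closed open_rectangles.
Proof.
move=> _ _ [B oB ->] [C oC ->]; exists (fun i => B i `&` C i).
  by move=> i; exact: openI.
apply/seteqP; split => [x [Bx Cx] i|x BCx]; first by split.
by split=> i; have [] := BCx i.
Qed.

Lemma measurable_rectangle (B : 'I_n -> set R) :
  (forall i, measurable (B i)) -> measurable (rectangle B).
Proof. exact: measurable_rV_box. Qed.

(** Open rectangles form a pi-system, so that measures and classes of sets can
    be compared on them alone. *)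
Lemma measurable_rV_open_rectangles :
  @measurable _ X = <<s open_rectangles >>.
Proof.
apply/seteqP; split; last first.
  apply: smallest_sub; first exact: sigma_algebra_measurable.
  move=> _ [B oB ->]; apply: measurable_rectangle => i; exact: open_measurable.
apply: smallest_sub; first exact: smallest_sigma_algebra.
rewrite -bigcup_seq => C /= [i _ [D mD <-]]; rewrite setTI.
suff : @measurable _ (measurableTypeR R) `<=`
    [set D | <<s open_rectangles >> (rV_coord i @^-1` D)] by exact.
rewrite /= (RGenOpens.measurableE R); apply: smallest_sub.
  split => [|A GA|F GF].
  - by rewrite /= preimage_set0; exact: sigma_algebra0.
  - by rewrite /= setTD -preimage_setC; exact: sigma_algebraC.
  - by rewrite /= preimage_bigcup; exact: sigma_algebra_bigcup.
move=> U /= [a [b ->]]; apply: sub_sigma_algebra => /=.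
exists (fun j => if j == i then `]a, b[%classic else setT).
  by move=> j; case: ifP => _ //; exact: openT.
apply/seteqP; split => [x xab j|x /(_ i)]; last by rewrite eqxx.
by case: eqP => [->|].
Qed.

Lemma measurable_reflection (c : X) : measurable_fun setT (fun x : X => c - x).
Proof.
apply: measurable_fun_rVP => i.
rewrite (_ : _ \o _ = (fun x : X => c ord0 i - rV_coord i x)); last first.
  by apply/funext => x /=; rewrite /rV_coord !mxE.
by apply: measurable_funB => //; exact: measurable_rV_coord.
Qed.

End rectangles.

Lemma lebesgue_measure_reflection (R : realType) (c : R) (A : set R) :
  measurable A ->
  lebesgue_measure ((fun t : R => c - t) @^-1` A) = lebesgue_measure A.
Proof.
move=> mA.
have mf : measurable_fun setT ((fun t : R => c - t) :
    measurableTypeR R -> measurableTypeR R) by exact: measurable_funB.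
pose m := measure_function_pushforward__canonical__measure_function_Measure
  (@lebesgue_measure R) mf.
apply/esym/(@lebesgue_measure_unique R m) => //= _ [[a b]] _ <-.
rewrite /pushforward /= (_ : _ @^-1` _ = `[c - b, c - a[%classic).
  rewrite !lebesgue_measure_itv/= !lte_fin ltrD2l ltrN2.
  by case: ifP => // _; rewrite -!EFinB; congr EFin; ring.
by apply/seteqP; split => x /=; rewrite !in_itv/= => /andP[? ?]; lra.
Qed.

Section sup_norm.
Context {R : realType} {n : nat}.

Lemma normr_coord_le (x : 'rV[R]_n) i : `|x ord0 i| <= `|x|.
Proof.
rewrite [leRHS]mx_normrE.
exact: (le_bigmax _ (fun ij => `|x ij.1 ij.2|) (ord0, i)).
Qed.

Lemma normr_rV_leP (x : 'rV[R]_n) (r : R) : 0 <= r ->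
  reflect (forall i, `|x ord0 i| <= r) (`|x| <= r).
Proof.
move=> r0; apply: (iffP idP) => [xr i|xr].
  exact: le_trans (normr_coord_le x i) xr.
rewrite [leLHS]mx_normrE; apply: bigmax_le => // -[i j] _ /=.
by rewrite ord1.
Qed.

Lemma normr_rV_ltP (x : 'rV[R]_n) (r : R) : 0 < r ->
  reflect (forall i, `|x ord0 i| < r) (`|x| < r).
Proof.
move=> r0; apply: (iffP idP) => [xr i|xr].
  exact: le_lt_trans (normr_coord_le x i) xr.
rewrite [ltLHS]mx_normrE; apply: bigmax_lt => // -[i j] _ /=.
by rewrite ord1.
Qed.

Lemma closed_cubeE (r : R) : 0 <= r ->
  [set x : 'rV[R]_n | `|x| <= r] = rectangle (fun=> `[- r, r]%classic).
Proof.
move=> r0; apply/seteqP; split => x /= xr.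
  by move=> i; rewrite /= in_itv/= -ler_norml; apply/normr_rV_leP.
by apply/normr_rV_leP => // i; have := xr i; rewrite /= in_itv/= ler_norml.
Qed.

Lemma closed_cube_lt0 (r : R) : r < 0 -> [set x : 'rV[R]_n | `|x| <= r] = set0.
Proof.
by move=> r0; apply/seteqP; split => // x /=; rewrite leNgt (lt_le_trans r0).
Qed.

End sup_norm.

Section invariance.
Context {R : realType} {n : nat}.
Local Notation X := 'rV[R]_n.
Local Notation mu := (lebesgue_rV (R := R) (n := n)).

Let open_cube (k : nat) : set X := rectangle (fun=> `]- k%:R, k%:R[%classic : set R).

Let lebesgue_rV_reflection_rectangle (c : X) (B : 'I_n -> set R) :
  (forall i, measurable (B i)) ->
  mu ((fun x => c - x) @^-1` rectangle B) = mu (rectangle B).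
Proof.
move=> mB; rewrite (_ : _ @^-1` _ = rectangle
      (fun i => (fun t => c ord0 i - t) @^-1` (B i))); last first.
  by apply/seteqP; split => x Bx i; have := Bx i; rewrite !mxE.
rewrite !lebesgue_rV_box//.
  by apply: eq_bigr => i _; rewrite lebesgue_measure_reflection//.
by move=> i; rewrite -[X in measurable X]setTI; exact: measurable_funB.
Qed.

Lemma lebesgue_rV_rectangle_lty (a b : 'I_n -> R) :
  (mu (rectangle (fun i => `[a i, b i]%classic : set R)) < +oo)%E.
Proof.
rewrite lebesgue_rV_box => [|i]; last exact: measurable_itv.
rewrite -ge0_fin_numE; last by apply: prode_ge0 => i _; exact: measure_ge0.
by apply: prode_fin_num => i _; rewrite lebesgue_measure_itv/=; case: ifP.
Qed.

(** Reflections are taken as the basic symmetry: each one maps rectangles to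
    rectangles, and a translation is the composite of two of them. *)
Lemma lebesgue_rV_reflection (c : X) (A : set X) : measurable A ->
  mu ((fun x => c - x) @^-1` A) = mu A.
Proof.
pose m : {measure set X -> \bar R} :=
  measure_function_pushforward__canonical__measure_function_Measure
    mu (measurable_reflection c).
move=> mA; apply: (measure_unique open_rectangles open_cube _ _ _ _ m mu) => //.
- exact: measurable_rV_open_rectangles.
- exact: open_rectangles_setI.
- by move=> i; exists (fun=> `]- i%:R, i%:R[%classic).
- rewrite -subTset => x _; exists (Num.truncn `|x|).+1 => // i /=.
  rewrite in_itv/= -ltr_norml; apply: le_lt_trans (truncnS_gt _).
  by rewrite (le_trans _ (normr_coord_le x i)).
- move=> _ [B oB ->]; rewrite /m/= /pushforward.
  by rewrite lebesgue_rV_reflection_rectangle// => i; exact: open_measurable.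
- move=> k; rewrite /m/= /pushforward lebesgue_rV_reflection_rectangle//.
  apply: le_lt_trans (lebesgue_rV_rectangle_lty (fun=> - k%:R) (fun=> k%:R)).
  apply: le_measure; rewrite ?inE; [exact: measurable_rectangle| |].
    by apply: measurable_rectangle => i; exact: measurable_itv.
  by move=> x xk i; apply: subset_itvW (xk i).
Qed.

Lemma ge0_integral_reflection (c : X) (f : X -> \bar R) :
  measurable_fun setT f -> (forall x, 0 <= f x)%E ->
  (\int[mu]_x f (c - x)%R = \int[mu]_x f x)%E.
Proof.
move=> mf f0.
pose m : {measure set X -> \bar R} :=
  measure_function_pushforward__canonical__measure_function_Measure
    mu (measurable_reflection c).
transitivity (\int[m]_x f x)%E; last first.
  by apply: eq_measure_integral => A mA _; exact: lebesgue_rV_reflection.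
by rewrite /m/= ge0_integral_pushforward//=; exact: measurable_reflection.
Qed.

Lemma ge0_integral_translation (c : X) (f : X -> \bar R) :
  measurable_fun setT f -> (forall x, 0 <= f x)%E ->
  (\int[mu]_x f (x + c)%R = \int[mu]_x f x)%E.
Proof.
move=> mf f0; rewrite -(ge0_integral_reflection 0 (f := fun x => f (x + c)))//.
  rewrite -(ge0_integral_reflection c (f := f))//.
  by apply: eq_integral => x _; rewrite sub0r addrC.
apply: measurableT_comp => //.
rewrite (_ : (fun x => _) = (fun x : X => (c - x)%R) \o (fun x : X => (0 - x)%R)).
  by apply: measurableT_comp; exact: measurable_reflection.
by apply/funext => x /=; rewrite sub0r opprK addrC.
Qed.

End invariance.

(** * Integrals of periodic functions over cells *)

Section cells.
Context {R : realType} {d : nat} (A : 'M[R]_d) (hA : A \in unitmx).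
Local Notation X := 'rV[R]_d.
Local Notation mu := (lebesgue_rV (R := R) (n := d)).

Definition lattice_vector (z : 'rV[int]_d) : X :=
  map_mx (fun m : int => m%:~R) z *m A.

Lemma lattice_vectorP z : lattice A (lattice_vector z).
Proof. by exists z. Qed.

Lemma lattice_vector_inj : injective lattice_vector.
Proof.
move=> y z /(congr1 (mulmx^~ (invmx A))); rewrite !mulmxK// => yz.
apply/rowP => i; have /rowP/(_ i) := yz; rewrite !mxE; exact: intr_inj.
Qed.

Lemma latticeN r : lattice A r -> lattice A (- r).
Proof.
move=> [z ->]; exists (- z); rewrite -mulNmx; congr (_ *m _).
by apply/rowP => i; rewrite !mxE intrN.
Qed.

Lemma latticeB r s : lattice A r -> lattice A s -> lattice A (r - s).
Proof.
move=> [y ->] [z ->]; exists (y - z); rewrite -mulmxBl; congr (_ *m _).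
by apply/rowP => i; rewrite !mxE intrB.
Qed.

Lemma measurable_translation (c : X) : measurable_fun setT (fun x : X => x + c).
Proof.
apply: measurable_fun_rVP => i.
rewrite (_ : _ \o _ = (fun x : X => rV_coord i x + c ord0 i)); last first.
  by apply/funext => x /=; rewrite /rV_coord !mxE.
by apply: measurable_funD => //; exact: measurable_rV_coord.
Qed.

Lemma measurable_preimage_translation (c : X) B : measurable B ->
  measurable [set x | B (x + c)].
Proof.
by move=> mB; rewrite -[X in measurable X]setTI; exact: measurable_translation.
Qed.

Lemma lebesgue_rV_translation (c : X) B : measurable B ->
  mu [set x | B (x + c)] = mu B.
Proof.
move=> mB; have mBc := measurable_preimage_translation c mB.
transitivity (\int[mu]_x (\1_B x)%:E)%E; last by rewrite integral_indic// setIT.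
rewrite -(ge0_integral_translation c)//=; last exact/measurable_EFinP.
transitivity (\int[mu]_x (\1_[set x | B (x + c)%R] x)%:E)%E => //.
by rewrite integral_indic// setIT.
Qed.

Lemma ae_translation (c : X) (P : X -> Prop) :
  {ae mu, forall x, P x} -> {ae mu, forall x, P (x + c)}.
Proof.
move=> [N [mN N0 PN]]; exists [set x | N (x + c)]; split.
- exact: measurable_preimage_translation.
- by rewrite lebesgue_rV_translation.
- by move=> x; exact: PN.
Qed.

(** A unit cell is a packing which is also a covering.  The two halves are kept
    apart because a large cube is a covering only, which is enough to bound
    integrals over the cell. *)
Definition packing (V : set X) := forall r, lattice A r -> r != 0 ->
  mu (V `&` [set x | V (x - r)]) = 0%E.

Definition covering (V : set X) :=
  {ae mu, forall x, exists2 r, lattice A r & V (x - r)}.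

Let at_most_one (a : nat -> \bar R) (c : \bar R) : (forall n, 0 <= a n <= c)%E ->
  (0 <= c)%E -> (forall m n, a m != 0%E -> a n != 0%E -> m = n) ->
  (\sum_(n <oo) a n <= c)%E.
Proof.
move=> a0c c0 a1; apply: lime_le.
  by apply: is_cvg_nneseries => n _ _; have /andP[] := a0c n.
apply: nearW => N; have [/existsP[/= k ak]|/existsPn/= a_0] :=
    boolP [exists k : 'I_N, a k != 0%E].
  rewrite big_mkord (bigD1 k)//= big1 ?adde0; last first.
    move=> i ik; apply/eqP; apply: contraNT ik => ai.
    by apply/eqP/val_inj/a1.
  by have /andP[] := a0c k.
by rewrite big_mkord big1// => i _; apply/eqP; have := a_0 i; rewrite negbK.
Qed.

Lemma ae_forall_countable (I : countType) (P : I -> X -> Prop) :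
  (forall i, {ae mu, forall x, P i x}) -> {ae mu, forall x, forall i, P i x}.
Proof.
move=> aeP; pose Q n x := if unpickle n is Some i then P i x else True.
have : {ae mu, forall x, forall n, Q n x}.
  apply/ae_foralln => n; rewrite /Q; case: (unpickle n) => [i|]; first exact: aeP.
  exact: nearW.
by apply: filterS => x Qx i; have := Qx (pickle i); rewrite /Q pickleK.
Qed.

(** The lattice is countable, so the overlaps of the translates of a packing
    lie together in one null set. *)
Lemma packing_unique V : measurable V -> packing V ->
  {ae mu, forall x y z, V (x + lattice_vector y) -> V (x + lattice_vector z) ->
                        y = z}.
Proof.
move=> mV pV; apply: ae_forall_countable => y; apply: ae_forall_countable => z.
have [->|yz] := eqVneq y z; first exact: nearW.
pose r := lattice_vector y - lattice_vector z.
have lr : lattice A r by apply: latticeB; exact: lattice_vectorP.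
have r0 : r != 0 by rewrite subr_eq0; apply: contra_neq yz; exact: lattice_vector_inj.
have : {ae mu, forall x, ~ (V x /\ V (x - r))}.
  exists (V `&` [set x | V (x - r)]); split; [|exact: pV|].
    by apply: measurableI => //; exact: measurable_preimage_translation.
  by move=> x /= /contrapT.
move=> /(ae_translation (lattice_vector y)); apply: filterS => x + Vy Vz.
by case; split => //; rewrite /r opprB addrACA subrr addr0.
Qed.

(** Almost every point of [V] lies in a translate of [W], so the integral over
    [V] is at most the sum over the lattice of the integrals over the pieces of
    [V] that lie in these translates.  Periodicity moves every piece into [W],
    where the pieces are almost disjoint because [V] is a packing. *)
Lemma ge0_integral_packing_covering V W (f : X -> \bar R) :
  measurable V -> packing V -> measurable W -> covering W ->
  measurable_fun setT f -> (forall x, 0 <= f x)%E -> lattice_periodic A f ->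
  (\int[mu]_(x in V) f x <= \int[mu]_(x in W) f x)%E.
Proof.
move=> mV pV mW cW mf f0 perf.
(* the lattice is enumerated by natural numbers; indices that code no lattice
   vector contribute the empty set *)
pose D n : set X := if @pickle_inv 'rV[int]_d n is Some z then
  V `&` [set x | W (x - lattice_vector z)] else set0.
pose E n : set X := if @pickle_inv 'rV[int]_d n is Some z then
  [set x | V (x + lattice_vector z)] `&` W else set0.
have mD n : measurable (D n).
  rewrite /D; case: pickle_inv => [z|]//; apply: measurableI => //.
  exact: measurable_preimage_translation.
have mE n : measurable (E n).
  rewrite /E; case: pickle_inv => [z|]//; apply: measurableI => //.
  exact: measurable_preimage_translation.
have mfS S : measurable S -> measurable_fun setT (f \_ S).
  by move=> mS; apply/(measurable_restrictT _ mS); exact: measurable_funS mf.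
have fS0 S x : (0 <= (f \_ S) x)%E by rewrite patchE; case: ifP.
have DE n : (\int[mu]_x (f \_ (D n)) x = \int[mu]_x (f \_ (E n)) x)%E.
  rewrite /D /E; case: pickle_inv => [z|]; last by [].
  rewrite -(ge0_integral_translation (lattice_vector z)) => [||x]; last 2 first.
  - apply: mfS; apply: measurableI => //.
    exact: measurable_preimage_translation.
  - exact: fS0.
  apply: eq_integral => x _; rewrite !patchE perf//; last exact: lattice_vectorP.
  congr (if _ then _ else _).
  by apply/idP/idP; rewrite !inE /= addrK.
rewrite integral_mkcond [leRHS]integral_mkcond.
apply: (@le_trans _ _ (\int[mu]_x (\sum_(n <oo) (f \_ (D n)) x))%E).
  apply: ae_ge0_le_integral => //.
  - exact: mfS.
  - by move=> x _; exact: nneseries_ge0.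
  - by apply: ge0_emeasurable_sum => // n x _; exact: mfS.
  move: cW; rewrite /covering; apply: filterS => x [r [z ->] Wx] _; rewrite patchE.
  case: ifPn => [Vx|_]; last exact: nneseries_ge0.
  apply: (@le_trans _ _ (f \_ (D (pickle z)) x)).
    by rewrite patchE /D pickleK_inv ifT// inE; split => //; exact: set_mem.
  have := @nneseries_lim_ge R (fun n => (f \_ (D n)) x) xpredT 0 (pickle z).+1.
  move=> /(_ (fun n _ _ => fS0 (D n) x)); apply: le_trans; rewrite /=.
  by rewrite big_nat_recr//= leeDr// sume_ge0.
rewrite integral_nneseries// => [|n]; last exact: mfS.
rewrite (eq_eseriesr (fun n _ => DE n)).
rewrite -integral_nneseries// => [|n]; last exact: mfS.
apply: ae_ge0_le_integral => //.
- by move=> x _; exact: nneseries_ge0.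
- by apply: ge0_emeasurable_sum => // n _; exact: mfS.
- exact: mfS.
move: (packing_unique mV pV); apply: filterS => x Vx _.
apply: at_most_one => // [n|m n].
  rewrite fS0/= !patchE; case: ifPn => //.
    rewrite inE /E; case: pickle_inv => // z [_ Wx]; by rewrite mem_set.
  by move=> _; case: ifPn.
have supp k : (f \_ (E k)) x != 0%E -> E k x.
  by rewrite patchE; case: ifPn => [/set_mem|_ /eqP].
move=> /supp Emx /supp Enx; move: Emx Enx; rewrite /E.
case En : (pickle_inv n) => [z|]; last by move=> _ [].
case Em : (pickle_inv m) => [y|]; last by case.
move=> [Vy _] [Vz _]; have yz := Vx _ _ Vy Vz; rewrite -yz in En.
have pK := @pickle_invK 'rV[int]_d.
have := pK m; rewrite Em /= => <-.
by have := pK n; rewrite En.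
Qed.

Lemma measurable_cube (r : R) : measurable [set x : X | `|x| <= r].
Proof.
have [r0|r0] := ltP r 0; first by rewrite closed_cube_lt0.
rewrite closed_cubeE//; apply: measurable_rectangle => i; exact: measurable_itv.
Qed.

Lemma lebesgue_rV_cube_lty (r : R) : (mu [set x : X | (`|x| <= r)%R] < +oo)%E.
Proof.
have [r0|r0] := ltP r 0; first by rewrite closed_cube_lt0 ?measure0.
by rewrite closed_cubeE//; exact: lebesgue_rV_rectangle_lty.
Qed.

(** Subtracting from [x] the lattice vector with the integer parts of its
    coordinates in the basis [A] leaves a combination of the rows of [A] with
    coefficients between 0 and 1. *)
Lemma covering_cube : exists r : R, covering [set x : X | `|x| <= r].
Proof.
pose r := \sum_i \sum_j `|A i j|; exists r; apply: nearW => x.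
have r0 : 0 <= r by apply: sumr_ge0 => i _; apply: sumr_ge0.
pose u := x *m invmx A; pose z : 'rV[int]_d := \row_i Num.floor (u ord0 i).
exists (lattice_vector z); first exact: lattice_vectorP.
have -> : x - lattice_vector z = (u - map_mx intr z) *m A.
  by rewrite mulmxBl mulmxKV.
apply/normr_rV_leP => // j; rewrite mxE; apply: le_trans (ler_norm_sum _ _ _) _.
apply: ler_sum => i _; apply: (@le_trans _ _ `|A i j|); last first.
  by rewrite (bigD1 j)//= lerDl sumr_ge0.
rewrite normrM !mxE ler_piMl// ger0_norm ?subr_ge0 ?floor_le_tmp//.
  by rewrite lerBlDr -[1]/(1%:~R) -intrD addrC ltW// floorD1_gt.
Qed.

End cells.

Section unit_cells.
Context {R : realType} {d : nat} (A : 'M[R]_d) (hA : A \in unitmx).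
Context (V : set 'rV[R]_d) (hV : unit_cell A V).
Local Notation X := 'rV[R]_d.
Local Notation mu := (lebesgue_rV (R := R) (n := d)).

Lemma unit_cell_measurable : measurable V. Proof. by case: hV. Qed.
Local Notation mV := unit_cell_measurable.

Lemma unit_cell_packing : packing A V.
Proof.
move=> r lr r0; case: hV => _ /(_ r lr r0) <- _; congr (mu (V `&` _)).
apply/seteqP; split => [x Vx|_ [x Vx <-]]; last by rewrite /= addrK.
by exists (x - r) => //; rewrite subrK.
Qed.

Lemma unit_cell_covering : covering A V. Proof. by case: hV. Qed.

Let Vc (c : X) : set X := [set x | V (x - c)].

Let mVc c : measurable (Vc c).
Proof. by apply: measurable_preimage_translation; exact: mV. Qed.

Let packing_Vc c : packing A (Vc c).
Proof.
move=> r lr r0; rewrite -(unit_cell_packing lr r0).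
rewrite -[RHS](lebesgue_rV_translation (- c)).
  congr (mu _); apply/seteqP; split => x []; rewrite /Vc /= => ? ?;
  by split; rewrite /= ?[_ - c - r]addrAC // [_ - r - c]addrAC.
apply: measurableI => //; first exact: mV.
by apply: measurable_preimage_translation; exact: mV.
Qed.

Let covering_Vc c : covering A (Vc c).
Proof.
move: (ae_translation (- c) unit_cell_covering).
apply: filterS => x [r lr Vx]; exists r => //.
by rewrite /Vc /= addrAC.
Qed.

(** A translate of a cell is again a cell, and two cells carry the same
    integral by two comparisons. *)
Lemma ge0_integral_cell_translation (c : X) (f : X -> \bar R) :
  measurable_fun setT f -> (forall x, 0 <= f x)%E -> lattice_periodic A f ->
  (\int[mu]_(x in V) f (x + c)%R = \int[mu]_(x in V) f x)%E.
Proof.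
move=> mf f0 perf; transitivity (\int[mu]_(x in Vc c) f x)%E.
  rewrite integral_mkcond [RHS]integral_mkcond.
  rewrite -[RHS](ge0_integral_translation c).
  - apply: eq_integral => x _; rewrite !patchE; congr (if _ then _ else _).
    by apply/idP/idP; rewrite !inE /Vc/= addrK.
  - by apply/(measurable_restrictT _ (mVc c)); exact: measurable_funS mf.
  - by move=> x; rewrite patchE; case: ifP.
by apply/eqP; rewrite eq_le !(ge0_integral_packing_covering (A := A))//;
  first [exact: mV|exact: unit_cell_packing|exact: unit_cell_covering].
Qed.

Lemma integral_cell_translation (c : X) (f : X -> \bar R) :
  measurable_fun setT f -> lattice_periodic A f ->
  (\int[mu]_(x in V) f (x + c)%R = \int[mu]_(x in V) f x)%E.
Proof.
move=> mf perf; rewrite integralE [RHS]integralE.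
congr (_ - _)%E.
  rewrite -[RHS](@ge0_integral_cell_translation c f^\+%E) => [||//|].
  - by apply: eq_integral => x _; rewrite !funeposE.
  - exact: measurable_funepos.
  - by move=> r lr x; rewrite !funeposE perf.
rewrite -[RHS](@ge0_integral_cell_translation c f^\-%E) => [||//|].
- by apply: eq_integral => x _; rewrite !funenegE.
- exact: measurable_funeneg.
- by move=> r lr x; rewrite !funenegE perf.
Qed.

Lemma ge0_integral_cell_lty (f : X -> \bar R) :
  measurable_fun setT f -> (forall x, 0 <= f x)%E -> lattice_periodic A f ->
  (forall r : R, \int[mu]_(x in [set x : X | (`|x| <= r)%R]) f x < +oo)%E ->
  (\int[mu]_(x in V) f x < +oo)%E.
Proof.
move=> mf f0 perf floc; have [r cr] := covering_cube hA.
apply: le_lt_trans (floc r).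
apply: (ge0_integral_packing_covering (A := A)) => //.
- exact: mV.
- exact: unit_cell_packing.
- exact: measurable_cube.
Qed.

Lemma unit_cell_lty : (mu V < +oo)%E.
Proof.
have := @ge0_integral_cell_lty (cst 1%E); rewrite integral_cst ?mul1e; last exact: mV.
apply=> // r; rewrite integral_cst ?mul1e; last exact: measurable_cube.
exact: lebesgue_rV_cube_lty.
Qed.

Lemma ae_cell_periodic (P : X -> Prop) :
  (forall r, lattice A r -> forall x, P (x + r) <-> P x) ->
  {ae mu, forall x, V x -> P x} -> {ae mu, forall x, P x}.
Proof.
move=> perP VP.
have this : {ae mu, forall x, forall z, V (x + lattice_vector A z) -> P (x + lattice_vector A z)}.
  apply: ae_forall_countable => z.
  exact: (ae_translation (P := fun x => V x -> P x) (lattice_vector A z) VP).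
have cV : {ae mu, forall x, exists2 r, lattice A r & V (x - r)}.
  exact: unit_cell_covering.
move: this cV; apply: filterS2 => x Pz [_ [z ->] Vx].
have := Pz (- z).
have -> : lattice_vector A (- z) = - lattice_vector A z.
  rewrite -mulNmx; congr (_ *m _).
  by apply/rowP => i; rewrite !mxE intrN.
move=> /(_ Vx) /perP; apply; apply: latticeN; exact: lattice_vectorP.
Qed.

(** A null cell would have a null orbit, which is almost the whole space. *)
Lemma unit_cell_gt0 : (0 < mu V)%E.
Proof.
rewrite lt0e measure_ge0 andbT; apply/negP => /eqP V0.
have : {ae mu, forall x : X, False}.
  apply: ae_cell_periodic => //.
  by exists V; split => //; [exact: mV|move=> x /= /not_implyP[]].
move=> [N [mN N0 sN]].
have : mu (rectangle (fun=> `[0, 1]%classic)) = 0%E.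
  apply: (subset_measure0 _ mN) => //.
    by apply: measurable_rectangle => i; exact: measurable_itv.
  by move=> x _; apply: sN => /=.
rewrite lebesgue_rV_box => [|i]; last exact: measurable_itv.
rewrite big1 => [/eqP|i _]; first by rewrite onee_eq0.
by rewrite lebesgue_measure_itv/= lte_fin ltr01 oppr0 adde0.
Qed.

End unit_cells.

(** * Continuity of translations in the mean square *)

Lemma cvge_exists_lt (R : realType) (u : nat -> \bar R) (l b : \bar R) :
  u @ \oo --> l -> (l < b)%E -> exists N, (u N < b)%E.
Proof.
by move=> ul /open_ereal_lt' /ul [N _ /(_ N (leqnn N))]; exists N.
Qed.

Lemma cvge_exists_gt (R : realType) (u : nat -> \bar R) (l b : \bar R) :
  u @ \oo --> l -> (b < l)%E -> exists N, (b < u N)%E.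
Proof.
by move=> ul /open_ereal_gt' /ul [N _ /(_ N (leqnn N))]; exists N.
Qed.

Section L2_translations.
Context {R : realType} {d : nat}.
Local Notation X := 'rV[R]_d.
Local Notation mu := (lebesgue_rV (R := R) (n := d)).

Lemma measurable_shift (f : X -> R) (c : X) :
  measurable_fun setT f -> measurable_fun setT (fun x : X => f (x + c)).
Proof. by move=> mf; exact: (measurableT_comp mf (measurable_translation c)). Qed.

Definition sqnorm (f : X -> R) : \bar R := (\int[mu]_x ((f x) ^+ 2)%:E)%E.

Lemma measurable_sq (f : X -> R) : measurable_fun setT f ->
  measurable_fun setT (fun x => ((f x) ^+ 2)%:E).
Proof. by move=> mf; apply/measurable_EFinP; exact: measurable_funX. Qed.

Lemma sqnorm_ge0 f : (0 <= sqnorm f)%E.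
Proof. by apply: integral_ge0 => x _; rewrite lee_fin sqr_ge0. Qed.

(** The factor 2 replaces the triangle inequality for the norm, so that no
    square root is needed. *)
Lemma sqnormD (f g : X -> R) : measurable_fun setT f -> measurable_fun setT g ->
  (sqnorm (fun x => f x + g x)%R <= 2%:E * (sqnorm f + sqnorm g))%E.
Proof.
move=> mf mg; rewrite /sqnorm -ge0_integralD//; try by
  [move=> x _; rewrite lee_fin sqr_ge0 | exact: measurable_sq].
rewrite -ge0_integralZl//; last 2 first.
- by apply: emeasurable_funD; exact: measurable_sq.
- by move=> x _; rewrite -EFinD lee_fin addr_ge0// sqr_ge0.
apply: ge0_le_integral => //.
- by move=> x _; rewrite lee_fin sqr_ge0.
- by apply: measurable_sq; exact: measurable_funD.
- by apply: measurable_funeM; apply: emeasurable_funD; exact: measurable_sq.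
- move=> x _; rewrite -EFinD -EFinM lee_fin.
  have := sqr_ge0 (f x - g x); nra.
Qed.

Lemma sqnorm_translation (f : X -> R) (c : X) : measurable_fun setT f ->
  sqnorm (fun x => f (x + c)) = sqnorm f.
Proof.
move=> mf; rewrite /sqnorm.
rewrite -(ge0_integral_translation c (f := fun x => ((f x) ^+ 2)%:E))//.
- exact: measurable_sq.
- by move=> x; rewrite lee_fin sqr_ge0.
Qed.

(** Continuity at 0 of [y |-> h (. + y)] in the mean square. *)
Definition translation_continuous (h : X -> R) :=
  measurable_fun setT h /\
  forall e : R, 0 < e -> exists2 D : R, 0 < D & forall y, `|y| < D ->
    (sqnorm (fun x => h (x + y)%R - h x)%R <= e%:E)%E.

Lemma translation_continuousD (f g : X -> R) : translation_continuous f ->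
  translation_continuous g -> translation_continuous (fun x => f x + g x).
Proof.
move=> [mf cf] [mg cg]; split=> [|e e0]; first exact: measurable_funD.
have e40 : 0 < e / 4 by lra.
have [D1 D10 HD1] := cf _ e40; have [D2 D20 HD2] := cg _ e40.
exists (Num.min D1 D2) => [|y]; first by rewrite lt_min D10.
rewrite lt_min => /andP[y1 y2].
rewrite (_ : (fun x => _) = fun x => (f (x + y) - f x) + (g (x + y) - g x)).
  apply: (le_trans (sqnormD _ _)); try by
    apply: measurable_funB => //; exact: measurable_shift.
  apply: (@le_trans _ _ (2%:E * ((e / 4)%:E + (e / 4)%:E))%E).
    by apply: lee_pmul => //; [rewrite adde_ge0 ?sqnorm_ge0|rewrite leeD ?HD1 ?HD2].
  by rewrite -EFinD -EFinM lee_fin; lra.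
by apply/funext => x; ring.
Qed.

Lemma translation_continuousZ (a : R) (f : X -> R) : translation_continuous f ->
  translation_continuous (fun x => a * f x).
Proof.
move=> [mf cf]; split=> [|e e0]; first exact: measurable_funM.
have [->|a0] := eqVneq a 0.
  exists 1 => // y _; rewrite /sqnorm.
  by under eq_integral do rewrite !mul0r subr0 expr0n/=; rewrite integral0 lee_fin ltW.
have a20 : 0 < a ^+ 2 by rewrite exprn_even_gt0.
have [D D0 HD] := cf _ (divr_gt0 e0 a20); exists D => // y yD.
rewrite /sqnorm; under eq_integral do rewrite -mulrBr exprMn EFinM.
rewrite ge0_integralZl//; last 3 first.
- by apply: measurable_sq; apply: measurable_funB => //; exact: measurable_shift.
- by move=> x _; rewrite lee_fin sqr_ge0.
- by rewrite lee_fin ltW.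
by rewrite muleC -lee_pdivlMr// -EFinM; exact: HD.
Qed.

Lemma translation_continuous0 : translation_continuous (fun=> 0).
Proof.
split=> // e e0; exists 1 => // y _; rewrite /sqnorm.
by under eq_integral do rewrite subrr expr0n/=; rewrite integral0 lee_fin ltW.
Qed.

Lemma translation_continuous_sum I (s : seq I) (F : I -> X -> R) :
  (forall i, translation_continuous (F i)) ->
  translation_continuous (fun x => \sum_(i <- s) F i x).
Proof.
move=> cF; elim: s => [|i s IHs].
  by under eq_fun do rewrite big_nil; exact: translation_continuous0.
by under eq_fun do rewrite big_cons; exact: translation_continuousD.
Qed.

(** Translations preserve [sqnorm], so an approximation of [h] approximates
    every translate of [h] equally well. *)
Lemma translation_continuous_approx (h : X -> R) : measurable_fun setT h ->
  (forall e : R, 0 < e -> exists2 h', translation_continuous h' &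
     (sqnorm (fun x => h x - h' x)%R <= e%:E)%E) ->
  translation_continuous h.
Proof.
(* the constant 16 makes [2 * (2 * (e / 16 + e / 16) + e / 16)] at most [e] *)
move=> mh H; split=> // e e0; have e80 : 0 < e / 16 by lra.
have [h' [mh' ch'] hh'] := H _ e80; have [D D0 HD] := ch' _ e80.
exists D => // y yD; pose u x := h x - h' x.
have mu' : measurable_fun setT u by exact: measurable_funB.
rewrite (_ : (fun x => _) =
    fun x => (u (x + y) + (-1) * u x) + (h' (x + y) - h' x)); last first.
  by apply/funext => x; rewrite /u; ring.
have mM : measurable_fun setT (fun x => -1 * u x) by exact: measurable_funM.
have mu'y := measurable_shift y mu'.
apply: (le_trans (sqnormD _ _)).
- exact: measurable_funD.
- by apply: measurable_funB => //; exact: measurable_shift.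
apply: (@le_trans _ _ (2%:E * (2%:E * ((e / 16)%:E + (e / 16)%:E) + (e / 16)%:E))%E).
  apply: lee_pmul => //; first by rewrite adde_ge0 ?sqnorm_ge0.
  apply: leeD; last exact: HD.
  apply: (le_trans (sqnormD _ _)) => //.
  apply: lee_pmul => //; first by rewrite adde_ge0 ?sqnorm_ge0.
  rewrite sqnorm_translation//; apply: leeD => //.
  by rewrite /sqnorm; under eq_integral do rewrite mulN1r sqrrN.
by rewrite -?(EFinD, EFinM) lee_fin; lra.
Qed.

Lemma sqnorm_dominated (h : X -> R) (h_ : nat -> X -> R) :
  measurable_fun setT h -> (forall n, measurable_fun setT (h_ n)) ->
  (forall n x, `|h_ n x| <= `|h x|) -> (forall x, h_ n x @[n --> \oo] --> h x) ->
  (sqnorm h < +oo)%E ->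
  sqnorm (fun x => h x - h_ n x) @[n --> \oo] --> 0%E.
Proof.
move=> mh mh_ h_h cvh hoo.
have [|||_ _] := @dominated_convergence _ _ _ mu setT measurableT
  (fun n x => ((h x - h_ n x) ^+ 2)%:E) (cst 0%E)
  (fun x => (4 * (h x) ^+ 2)%:E)
  (fun n => measurable_sq (measurable_funB mh (mh_ n)))
  (measurable_cst _).
- apply: nearW => x _; apply: cvg_EFin; first exact: nearW.
  have cv : h x - h_ n x @[n --> \oo] --> 0.
    by rewrite -(subrr (h x)); apply: cvgB (cvh x); exact: cvg_cst.
  by rewrite -(mulr0 0); under eq_fun do rewrite expr2; exact: cvgM.
- apply/integrableP; split.
    by apply/measurable_EFinP; apply: measurable_funM => //; exact: measurable_funX.
  rewrite (eq_integral (fun x => 4%:E * ((h x) ^+ 2)%:E)%E) => [|x _]; last first.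
    by rewrite -EFinM gee0_abs// lee_fin mulr_ge0// sqr_ge0.
  rewrite ge0_integralZl// ?lte_mul_pinfty//; first exact: measurable_sq.
  by move=> x _; rewrite lee_fin sqr_ge0.
- apply: nearW => x n _; rewrite gee0_abs ?lee_fin ?sqr_ge0//.
  have := h_h n x; rewrite -(real_normK (num_real (h x - h_ n x))).
  rewrite -(real_normK (num_real (h x))).
  have := ler_normB (h x) (h_ n x); have := normr_ge0 (h x - h_ n x).
  nra.
- by rewrite integral0.
Qed.

Lemma translation_continuous_dominated (h : X -> R) (h_ : nat -> X -> R) :
  measurable_fun setT h -> (forall n, translation_continuous (h_ n)) ->
  (forall n x, `|h_ n x| <= `|h x|) -> (forall x, h_ n x @[n --> \oo] --> h x) ->
  (sqnorm h < +oo)%E -> translation_continuous h.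
Proof.
move=> mh ch_ h_h cvh hoo; apply: translation_continuous_approx => // e e0.
have mh_ n : measurable_fun setT (h_ n) by have [] := ch_ n.
have := sqnorm_dominated mh mh_ h_h cvh hoo.
have e20 : (0 < e%:E)%E by rewrite lte_fin.
move=> /cvge_exists_lt/(_ e20)[N hN].
by exists (h_ N); [exact: ch_|exact: ltW].
Qed.

Let cube (k : R) : set X := rectangle (fun=> `]- k, k[%classic : set R).

(** The set [B] shrunk by [1 / (m + 1)]; if [B] is open, these sets exhaust it. *)
Let inner_side (B : set R) (m : nat) : set R :=
  [set s | forall t, `|s - t| < m.+1%:R^-1 -> B t].

Let measurable_inner_side B m : measurable (inner_side B m).
Proof.
rewrite (_ : inner_side B m = ~` (\bigcup_(t in ~` B) ball t m.+1%:R^-1)).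
  apply: measurableC; apply: open_measurable.
  by apply: bigcup_open => t _; exact: ball_open.
apply/seteqP; split=> [s sB [t Bt]|s sB t st]; rewrite /ball/=.
  by rewrite distrC => /sB.
by apply: contrapT => Bt; apply: sB; exists t => //; rewrite /ball/= distrC.
Qed.

(** Let [C m] be the set of the points which no displacement of norm less than
    [1 / (m + 1)] takes out of the rectangle [B].  For such a displacement the
    symmetric difference of [B] and its translate avoids [C m], whence its
    measure is at most [2 (mu B - mu (C m))], and [C m] exhausts [B]. *)
Lemma translation_continuous_open_rectangle (B : 'I_d -> set R) :
  (forall i, open (B i)) -> (mu (rectangle B) < +oo)%E ->
  translation_continuous \1_(rectangle B).
Proof.
move=> oB Boo.
have mB : measurable (rectangle B).
  by apply: measurable_rectangle => i; exact: open_measurable.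
have mI C : measurable C -> measurable_fun setT (fun x : X => (\1_C x : R)%:E).
  by move=> mC; apply/measurable_EFinP; exact: measurable_indic.
split=> [|e e0]; first exact: measurable_indic.
pose C m : set X := rectangle (fun i => inner_side (B i) m).
have mC m : measurable (C m) by apply: measurable_rectangle.
have CB m : C m `<=` rectangle B.
  by move=> x Cx i; apply: (Cx i); rewrite subrr normr0.
have ndC : nondecreasing_seq C.
  move=> m n mn; apply/subsetPset => x Cx i t xt; apply: (Cx i).
  by rewrite (lt_le_trans xt)// lef_pV2 ?posrE// ler_nat.
have CU : \bigcup_m C m = rectangle B.
  apply/seteqP; split=> [x [m _]|x Bx]; first exact: CB.
  have /choice[m Hm] : forall i, exists m, inner_side (B i) m (x ord0 i).
    move=> i; have /(_ (B i)) := nbhs_ballP (x ord0 i).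
    move=> [/(_ (open_nbhs_nbhs (conj (oB i) (Bx i)))) [r /= r0 rB] _].
    exists (Num.truncn r^-1) => t xt; apply: rB; rewrite /ball/=.
    rewrite (lt_trans xt)// -[ltRHS]invrK ltf_pV2 ?posrE ?invr_gt0//.
    exact: truncnS_gt.
  exists (\max_i m i)%N => // i t xt; apply: (Hm i).
  by rewrite (lt_le_trans xt)// lef_pV2 ?posrE// ler_nat ltnS leq_bigmax.
have := @nondecreasing_cvg_mu _ _ _ mu C mC (bigcupT_measurable _ mC) ndC.
rewrite CU => cvC.
have Bfin : mu (rectangle B) \is a fin_num by rewrite ge0_fin_numE.
have e20 : 0 < e / 2 by lra.
have lt : (mu (rectangle B) - (e / 2)%:E < mu (rectangle B))%E.
  by rewrite lteBlDr// lteDl// lte_fin.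
have [m Cm] : exists m, (mu (rectangle B) <= mu (C m) + (e / 2)%:E)%E.
  have [N] := cvge_exists_gt cvC lt.
  by rewrite lteBlDr// => /ltW; exists N.
exists m.+1%:R^-1 => [|y ym]; first by rewrite invr_gt0.
have key : (sqnorm (fun x => \1_(rectangle B) (x + y) - \1_(rectangle B) x)%R +
  2%:E * mu (C m) <= 2%:E * mu (rectangle B))%E.
  have I2 D : measurable D -> mu D = (\int[mu]_x (\1_D x)%:E)%E.
    by move=> mD; rewrite integral_indic// setIT.
  rewrite [leRHS]mule_natl mule2n.
  rewrite -{1}(lebesgue_rV_translation y mB) (I2 (C m))// (I2 (rectangle B))//.
  rewrite (I2 [set x | _])//; last exact: measurable_preimage_translation.
  have mBy := measurable_preimage_translation y mB.
  rewrite -ge0_integralD//; try by [move=> x _; rewrite lee_fin|exact: mI].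
  rewrite -ge0_integralZl//; try by [move=> x _; rewrite lee_fin|exact: mI].
  rewrite /sqnorm -ge0_integralD//; first last.
  - by apply: measurable_funeM; exact: mI.
  - apply: measurable_sq; apply: measurable_funB; last exact: measurable_indic.
    by apply: (@measurable_shift (\1_(rectangle B))); exact: measurable_indic.
  - by move=> x _; rewrite lee_fin sqr_ge0.
  apply: ge0_le_integral => //.
  - by move=> x _; rewrite adde_ge0// lee_fin sqr_ge0.
  - apply: emeasurable_funD; last by apply: measurable_funeM; exact: mI.
    apply: measurable_sq; apply: measurable_funB; last exact: measurable_indic.
    by apply: (@measurable_shift (\1_(rectangle B))); exact: measurable_indic.
  - by apply: emeasurable_funD; exact: mI.
  move=> x _; rewrite -EFinM -!EFinD lee_fin !indicE.
  have [xC|xC] := boolP (x \in C m).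
    have Bx : rectangle B x by apply: (CB m); exact: set_mem.
    have Bxy : rectangle B (x + y).
      move=> i; move/set_mem: xC => /(_ i); apply; rewrite mxE opprD addrA subrr sub0r normrN.
      exact: le_lt_trans (normr_coord_le _ _) ym.
    rewrite (mem_set Bx) (mem_set Bxy) [x \in [set _ | _]]mem_set//= subrr.
    by rewrite expr0n/=; lra.
  rewrite (_ : (x \in [set z | rectangle B (z + y)]) = (x + y \in rectangle B)); last first.
    by apply/idP/idP => /set_mem ?; apply: mem_set.
  case: (x + y \in rectangle B) ; case: (x \in rectangle B);
    rewrite /= ?subrr ?subr0 ?sub0r ?sqrrN ?expr1n ?expr0n/=; lra.
have Cfin : mu (C m) \is a fin_num.
  by rewrite ge0_fin_numE// (le_lt_trans _ Boo)// le_measure// inE.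
have le2 : (2%:E * mu (rectangle B) <= 2%:E * mu (C m) + e%:E)%E.
  apply: (@le_trans _ _ (2%:E * (mu (C m) + (e / 2)%:E))%E).
    exact: lee_pmul.
  rewrite ge0_muleDr; [|exact: measure_ge0|by rewrite lee_fin ltW].
  by apply: leeD => //; rewrite -EFinM lee_fin; lra.
have := le_trans key le2; rewrite addeC leeD2lE// fin_numM//.
Qed.


Let cube_lty k C : measurable C -> (mu (C `&` cube k) < +oo)%E.
Proof.
move=> mC; apply: le_lt_trans (lebesgue_rV_rectangle_lty (fun=> - k) (fun=> k)).
apply: le_measure; rewrite ?inE.
- by apply: measurableI => //; apply: measurable_rectangle => i; exact: measurable_itv.
- by apply: measurable_rectangle => i; exact: measurable_itv.
- by move=> x [_ xk] i; apply: subset_itvW (xk i).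
Qed.

Let measurable_cubeo k : measurable (cube k).
Proof. by apply: measurable_rectangle => i; exact: measurable_itv. Qed.

Let sqnorm_indic C : measurable C -> sqnorm \1_C = mu C.
Proof.
move=> mC; transitivity (\int[mu]_x (\1_C x)%:E)%E; last first.
  by rewrite integral_indic// setIT.
by apply: eq_integral => x _; rewrite indicE; case: (_ \in _); rewrite ?expr1n ?expr0n.
Qed.

(** The sets for which the statement holds form a lambda-system; intersecting
    with a cube keeps the measures finite, as limits of increasing unions
    require. *)
Lemma translation_continuous_indic (k : R) (C : set X) : measurable C ->
  translation_continuous \1_(C `&` cube k).
Proof.
pose H : set (set X) :=
  [set C | measurable C /\ translation_continuous \1_(C `&` cube k)].
suff : @measurable _ X `<=` H by move=> /[apply] -[].
rewrite measurable_rV_open_rectangles.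
apply: lambda_system_subset => //; first exact: open_rectangles_setI; last first.
  move=> _ [B oB ->]; split.
    by apply: measurable_rectangle => i; exact: open_measurable.
  rewrite (_ : _ `&` _ = rectangle (fun i => B i `&` `]- k, k[%classic)); last first.
    apply/seteqP; split => [x [Bx kx] i|x Bkx]; first by split.
    by split => i; have [] := Bkx i.
  apply: translation_continuous_open_rectangle => [i|].
    by apply: openI => //; exact: interval_open.
  apply: le_lt_trans (cube_lty k measurableT); apply: le_measure; rewrite ?inE.
  - apply: measurable_rectangle => i; apply: open_measurable.
    by apply: openI => //; exact: interval_open.
  - by apply: measurableI => //; exact: measurable_cubeo.
  - by move=> x Bkx; split => // i; have [] := Bkx i.
split => //.
- split => //; rewrite setTI; apply: translation_continuous_open_rectangle => [i|].
    exact: interval_open.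
  by rewrite -[rectangle _]setTI; exact: cube_lty.
- move=> A B BA [mA cA] [mB cB]; split; first exact: measurableD.
  rewrite (_ : \1_(_) = (fun x => \1_(A `&` cube k) x + (-1) * \1_(B `&` cube k) x)).
    by apply: translation_continuousD => //; exact: translation_continuousZ.
  apply/funext => x; rewrite !indicE ![_ \in _ `&` cube k]in_setI in_setD.
  have := BA x; case: (boolP (x \in A)) => xA; case: (boolP (x \in B)) => xB;
    case: (x \in cube k) => //= AB; try lra.
  by move/set_mem/AB: xB => /mem_set; rewrite (negbTE xA).
- move=> F ndF HF; have mF n : measurable (F n) by have [] := HF n.
  have mU : measurable (\bigcup_n F n) by exact: bigcupT_measurable.
  have mUk : measurable (\bigcup_n F n `&` cube k) by exact: measurableI.
  split => //; apply: (@translation_continuous_dominated _ (fun n => \1_(F n `&` cube k))).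
  + exact: measurable_indic.
  + by move=> n; have [] := HF n.
  + move=> n x; rewrite !ger0_norm// !indicE ler_nat !in_setI.
    case: (boolP (x \in F n)) => // /set_mem xF.
    by rewrite (_ : x \in \bigcup_m F m)//; apply: mem_set; exists n.
  + move=> x; apply: cvg_near_cst; rewrite !indicE !in_setI.
    have [/set_mem[n _ Fnx]|xF] := boolP (x \in \bigcup_n F n).
      exists n => // m /= nm; rewrite indicE in_setI (_ : x \in F m)//.
      by apply: mem_set; have /subsetPset := ndF _ _ nm; exact.
    apply: nearW => m; rewrite indicE in_setI (_ : x \in F m = false)//.
    by apply: memNset => Fm; move/negP: xF; apply; apply: mem_set; exists m.
  + by rewrite sqnorm_indic//; exact: cube_lty.
Qed.

Import HBNNSimple.

(** Simple functions approximate from below, with domination by the square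
    integrable limit. *)
Lemma translation_continuous_local (k : R) (h : X -> R) :
  measurable_fun setT h ->
  (sqnorm (fun x => \1_(cube k) x * h x)%R < +oo)%E ->
  translation_continuous (fun x => \1_(cube k) x * h x).
Proof.
wlog h0 : h / forall x, 0 <= h x.
  move=> wlg mh hoo.
  have -> : (fun x => \1_(cube k) x * h x) = (fun x =>
      \1_(cube k) x * h^\+ x + (-1) * (\1_(cube k) x * h^\- x)).
    by apply/funext => x; rewrite mulN1r -mulrBr -[in LHS](funrposBneg h).
  have le (g : X -> R) : (forall x, `|g x| <= `|h x|) -> measurable_fun setT g ->
      (sqnorm (fun x => \1_(cube k) x * g x)%R < +oo)%E.
    move=> gh mg; apply: le_lt_trans hoo; apply: ge0_le_integral => //.
    - by move=> x _; rewrite lee_fin sqr_ge0.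
    - by apply: measurable_sq; apply: measurable_funM.
    - by apply: measurable_sq; apply: measurable_funM.
    - move=> x _; rewrite lee_fin !exprMn ler_wpM2l ?sqr_ge0//.
      by rewrite -(real_normK (num_real (g x))) -(real_normK (num_real (h x))) lerXn2r ?nnegrE.
  apply: translation_continuousD; last apply: translation_continuousZ; apply: wlg => //.
  - exact: measurable_funrpos.
  - apply: le; last exact: measurable_funrpos.
    by move=> x; rewrite ger0_norm// -[leRHS](congr1 (@^~ x) (funrposDneg h)) lerDl.
  - exact: measurable_funrneg.
  - apply: le; last exact: measurable_funrneg.
    by move=> x; rewrite ger0_norm// -[leRHS](congr1 (@^~ x) (funrposDneg h)) lerDr.
move=> mh hoo; pose g x := \1_(cube k) x * h x.
have g0 x : 0 <= g x by rewrite mulr_ge0.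
have mg : measurable_fun setT g by apply: measurable_funM.
have mgE : measurable_fun setT (EFin \o g) by exact/measurable_EFinP.
pose f := nnsfun_approx measurableT mgE.
have fg n x : f n x <= g x.
  by rewrite -lee_fin nnsfun_approxE; apply: le_approx => // y _; rewrite lee_fin.
apply: (@translation_continuous_dominated _ (fun n => f n)) => //.
- move=> n; rewrite (_ : (f n : X -> R) = (fun x =>
      \sum_(i <- finmap.enum_fset (fset_set (range (f n)))) i * \1_(f n @^-1` [set i] `&` cube k) x)).
    apply: translation_continuous_sum => i.
    by apply: translation_continuousZ; exact: translation_continuous_indic.
  apply/funext => x /=; have [xk|xk] := boolP (x \in cube k).
    rewrite fimfunE fsbig_finite//=; apply: eq_bigr => i _; congr (_ * _).
    by rewrite !indicE in_setI xk andbT.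
  rewrite big1 => [|i _]; last by rewrite indicE in_setI (negbTE xk) andbF mulr0.
  apply/eqP; rewrite eq_le fun_ge0 andbT (le_trans (fg n x))// /g indicE.
  by rewrite (negbTE xk) mul0r.
- move=> n x; rewrite -/(g x) (ger0_norm (g0 x)) ger0_norm; first exact: fg.
  exact: fun_ge0.
- move=> x; have := @cvg_nnsfun_approx _ _ _ _ measurableT _ mgE _ x I.
  by move=> /(_ (fun y _ => _))/fine_cvgP[].
Qed.

Lemma L2loc_translation_continuous (h : X -> R) (r e : R) : L2loc h -> 0 < e ->
  exists2 D : R, 0 < D & forall y : X, `|y| < D ->
    (\int[mu]_(x in [set x : X | (`|x| <= r)%R]) ((h (x + y) - h x) ^+ 2)%:E <= e%:E)%E.
Proof.
move=> [mh hoo] e0; pose k := `|r| + 2.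
have xk x : `|x| < k -> x \in cube k.
  move=> /normr_rV_ltP xk; apply: mem_set => i /=; rewrite in_itv/= -ltr_norml.
  by apply: xk; rewrite /k; have := normr_ge0 r; lra.
have [|_ /(_ e e0)[D D0 HD]] := translation_continuous_local (k := k) mh.
  apply: le_lt_trans (hoo k); rewrite [leRHS]integral_mkcond.
  apply: ge0_le_integral => //.
  - by move=> x _; rewrite lee_fin sqr_ge0.
  - by apply: measurable_sq; exact: measurable_funM.
  - apply/(measurable_restrictT _ (measurable_cube k)).
    by apply: measurable_funS (measurable_sq mh).
  move=> x _; rewrite patchE indicE; case: (boolP (x \in cube k)) => [/set_mem xc|_].
    rewrite mem_set ?mul1r//=; apply/normr_rV_leP => [|i].
      by rewrite /k; have := normr_ge0 r; lra.
    by have := xc i; rewrite /= in_itv/= -ltr_norml => /ltW.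
  by rewrite mul0r expr0n/=; case: ifP => // _; rewrite lee_fin sqr_ge0.
exists (Num.min D 1) => [|y]; first by rewrite lt_min D0/=.
rewrite lt_min => /andP[/HD yD y1]; apply: le_trans yD.
rewrite integral_mkcond; apply: ge0_le_integral => //.
- by move=> x _; rewrite patchE; case: ifP => // _; rewrite lee_fin sqr_ge0.
- apply/(measurable_restrictT _ (measurable_cube r)).
  apply: (measurable_funS measurableT) => //; apply: measurable_sq.
  by apply: measurable_funB => //; exact: measurable_shift.
- apply: measurable_sq; apply: measurable_funB; last exact: measurable_funM.
  by apply: (@measurable_shift (fun x => \1_(cube k) x * h x)); exact: measurable_funM.
move=> x _; rewrite patchE; case: ifPn => [/set_mem/= xr|_]; last first.
  by rewrite lee_fin sqr_ge0.
rewrite !indicE !xk ?mul1r//.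
  by rewrite (le_lt_trans xr)// /k; have := ler_norm r; lra.
rewrite (le_lt_trans (ler_normD _ _))// /k; have := ler_norm r; lra.
Qed.

End L2_translations.

(** * Smooth bumps and test functions *)

Lemma is_derive_line (R : realType) (V : normedModType R) (k : V -> R)
    (x v : V) (a : R) :
  is_derive x v k a <-> is_derive (0 : R) 1 (fun h : R => k (h *: v + x)) a.
Proof.
have E : 'D_v k x = 'D_1 (fun h : R => k (h *: v + x)) 0.
  rewrite /derive; set u := fun h => h^-1 *: _.
  set w := fun h => h^-1 *: _; suff -> : u = w by [].
  by rewrite funeqE /u /w => h /=; rewrite addr0 scale0r add0r [_%:A]mulr1.
split=> -[dk ka]; split; [exact: (derivable1P k x v).1| |
  exact: (derivable1P k x v).2|]; [rewrite -E|rewrite E]; exact: ka.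
Qed.

Lemma is_derive_chain (R : realType) (V : normedModType R) (f : R -> R)
    (g : V -> R) (x v : V) (df dg : R) :
  is_derive x v g dg -> is_derive (g x) 1 f df ->
  is_derive x v (f \o g) (df * dg).
Proof.
move=> /is_derive_line [dgl gE] [dfx fE]; apply/is_derive_line.
pose l (h : R) := g (h *: v + x).
have l0 : l 0 = g x by rewrite /l scale0r add0r.
have dfl : derivable f (l 0) 1 by rewrite l0.
split.
  apply: (derivable1_diffP (f \o l) 0).2.
  apply: (@differentiable_comp _ _ _ _ l f).
    exact: ((derivable1_diffP l 0).1 dgl).
  exact: ((derivable1_diffP f (l 0)).1 dfl).
have := derive1_comp dgl dfl; rewrite /comp /l !derive1E => ->.
by rewrite gE -/(l 0) l0 fE.
Qed.

Section flat_exponential.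
Context {R : realType}.

(** The family [t ^ - n * exp (- 1 / t)], extended by 0 to the left half line, has
    a span stable under differentiation: the derivative of the [n]-th member is
    [- n] times the next one plus the one after. *)
Definition flat_exp (n : nat) (t : R) : R :=
  if 0 < t then t^-1 ^+ n * expR (- t^-1) else 0.

Lemma flat_exp_le0 n t : t <= 0 -> flat_exp n t = 0.
Proof. by rewrite /flat_exp ltNge => ->. Qed.

Lemma flat_exp_ge0 n t : 0 <= flat_exp n t.
Proof.
rewrite /flat_exp; case: ifPn => // t0.
by rewrite mulr_ge0 ?expR_ge0// exprn_ge0// invr_ge0 ltW.
Qed.

Lemma flat_exp_gt0 n t : 0 < t -> 0 < flat_exp n t.
Proof. by move=> t0; rewrite /flat_exp t0 mulr_gt0 ?expR_gt0// exprn_gt0// invr_gt0. Qed.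

Lemma flat_exp_le n t : 0 < t -> flat_exp n t <= n.+1`!%:R * t.
Proof.
move=> t0; rewrite /flat_exp t0 expRN.
have ti0 : 0 <= t^-1 by rewrite invr_ge0 ltW.
rewrite ler_pdivrMr ?expR_gt0//.
apply: (@le_trans _ _ (n.+1`!%:R * t * (t^-1 ^+ n.+1 / n.+1`!%:R))).
  rewrite le_eqVlt; apply/orP; left; apply/eqP; rewrite exprS; field.
  by rewrite pnatr_eq0 -lt0n fact_gt0 gt_eqF.
rewrite ler_wpM2l//; first by rewrite mulr_ge0// ltW.
by rewrite (le_trans _ (expR_ge1Dxn n ti0))// lerDr.
Qed.

(** The exponential series gives [exp (1 / t) >= t ^ - (n + 1) / (n + 1)!], so
    [flat_exp n t] is at most [(n + 1)! * t].  Since the quotient of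
    [flat_exp n] by [t] is [flat_exp n.+1], this limit is also the derivative
    at 0. *)
Lemma flat_exp_cvg0 n : flat_exp n t @[t --> 0^'] --> 0.
Proof.
apply/cvgrPdist_le => e e0; near=> t.
rewrite sub0r normrN ger0_norm ?flat_exp_ge0//.
have [t0|t0] := leP t 0; first by rewrite flat_exp_le0// ltW.
apply: (le_trans (flat_exp_le n t0)).
rewrite -ler_pdivlMl ?ltr0n ?fact_gt0//.
apply: (le_trans (ler_norm t)).
near: t; apply: dnbhs0_le; rewrite mulr_gt0// invr_gt0 ltr0n fact_gt0//.
Unshelve. all: by end_near. Qed.

Lemma is_derive_flat_exp n (t : R) :
  is_derive t 1 (flat_exp n) (- (n%:R * flat_exp n.+1 t) + flat_exp n.+2 t).
Proof.
have [t0|t0|->] := ltgtP t 0.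
- rewrite !flat_exp_le0 ?ltW// mulr0 oppr0 addr0.
  apply: (@near_eq_is_derive _ _ _ (cst (0 : R))).
  near=> s; rewrite /= flat_exp_le0// ltW//.
  by near: s; exact: lt_nbhsl.
- apply: (@near_eq_is_derive _ _ _ ((fun s : R => s^-1) ^+ n * (expR \o (- (fun s : R => s^-1))))).
    near=> s; have s0 : 0 < s by near: s; exact: lt_nbhsr.
    by rewrite /flat_exp s0 fctE exprfctE.
  have t0' : t != 0 by rewrite gt_eqF.
  have dV : is_derive t 1 (fun s : R => s^-1) (- t^-1 ^+ 2).
    split; first exact: derivableV.
    by rewrite deriveV// derive_id [LHS]mulr1 exprVn.
  have dX := is_deriveX n dV.
  have dE := is_derive_chain (is_deriveN dV) (is_derive_expR (- t^-1)).
  apply: is_derive_eq (is_deriveM dX dE) _.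
  rewrite /flat_exp t0 !exprfctE /= /GRing.scale /=.
  case: n {dX} => [|n] /=; rewrite ?mul0r ?expr0 !exprS ?expr0.
    by ring.
  by ring.
- rewrite !flat_exp_le0// mulr0 oppr0 addr0.
  have H : h^-1 *: ((flat_exp n \o shift 0) (h *: 1) - flat_exp n 0) @[h --> 0^'] --> (0:R).
    apply: cvg_trans (flat_exp_cvg0 n.+1).
    apply: near_eq_cvg; near=> h.
    rewrite /= addr0 [h *: 1]mulr1 (flat_exp_le0 _ (lexx 0)) subr0 /flat_exp.
    case: ifP => h0; last by rewrite scaler0.
    by rewrite exprS -mulrA.
  by split; [apply/cvg_ex; exists 0|exact/cvg_lim].
Unshelve. all: by end_near. Qed.

End flat_exponential.

Section test_functions.
Context {R : realType} {d : nat}.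
Local Notation X := 'rV[R]_d.
Local Notation dir i := (delta_mx ord0 i : X).

(** A class of functions that contains the bumps, is closed under partial
    derivatives, and consists of continuous functions; such a class lies in
    every [Ck k]. *)
Inductive smooth_class : (X -> R) -> Prop :=
| smooth_cst c : smooth_class (fun=> c)
| smooth_flat n c s i : smooth_class (fun x => flat_exp n (c + s * x ord0 i))
| smooth_add f g : smooth_class f -> smooth_class g ->
    smooth_class (fun x => f x + g x)
| smooth_mul f g : smooth_class f -> smooth_class g ->
    smooth_class (fun x => f x * g x).

Let is_derive_coord (i j : 'I_d) (c s : R) (x : X) :
  is_derive x (dir j) (fun y : X => c + s * y ord0 i) (s * (i == j)%:R).
Proof.
have H : (fun h : R => h^-1 *: (((fun y : X => c + s * y ord0 i) \o shift x)
    (h *: dir j) - (c + s * x ord0 i))) @ 0^' --> s * (i == j)%:R.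
  apply: cvg_near_cst; near=> h; have h0 : h != 0 by near: h; exact: nbhs_dnbhs_neq.
  by rewrite /GRing.scale /= !mxE eqxx /= eq_sym; field.
by split; [apply/cvg_ex; eexists; exact: H|exact/cvg_lim].
Unshelve. all: by end_near. Qed.

Lemma smooth_class_derive (f : X -> R) : smooth_class f -> forall j, exists2 g,
  smooth_class g & forall x, is_derive x (dir j) f (g x).
Proof.
move=> sf j; elim: sf => {f} [c|n c s i|f g _ [f' sf' df] _ [g' sg' dg]|
  f g sf [f' sf' df] sg [g' sg' dg]].
- by exists (fun=> 0); [exact: smooth_cst|move=> x; exact: is_derive_cst].
- exists (fun x => ((- n%:R) * flat_exp n.+1 (c + s * x ord0 i) +
      flat_exp n.+2 (c + s * x ord0 i)) * (s * (i == j)%:R)).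
    apply: smooth_mul; last exact: smooth_cst.
    apply: smooth_add; last exact: smooth_flat.
    by apply: smooth_mul; [exact: smooth_cst|exact: smooth_flat].
  move=> x; rewrite mulNr.
  exact: (is_derive_chain (is_derive_coord i j c s x) (is_derive_flat_exp n _)).
- exists (fun x => f' x + g' x); first exact: smooth_add.
  by move=> x; exact: is_deriveD.
- exists (fun x => f x * g' x + g x * f' x); last by move=> x; exact: is_deriveM.
  by apply: smooth_add; exact: smooth_mul.
Qed.

Let flat_exp_continuous n : continuous (@flat_exp R n).
Proof.
move=> t; apply/differentiable_continuous/derivable1_diffP.
by have [] := is_derive_flat_exp n t.
Qed.

Lemma smooth_class_continuous f : smooth_class f -> continuous f.
Proof.
elim => {f} [c|n c s i|f g _ cf _ cg|f g _ cf _ cg] x.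
- exact: cst_continuous.
- apply: (@continuous_comp _ _ _ (fun y : X => c + s * y ord0 i)).
    apply: (@continuousD _ _ _ (cst c) (fun y : X => s * y ord0 i)).
      exact: cst_continuous.
    apply: (@continuousM _ _ (cst s) (fun y : X => y ord0 i)).
      exact: cst_continuous.
    exact: coord_continuous.
  exact: flat_exp_continuous.
- exact: (continuousD (cf x) (cg x)).
- exact: (continuousM (cf x) (cg x)).
Qed.

Lemma smooth_class_Ck f k : smooth_class f -> Ck k f.
Proof.
elim: k f => [|k IHk] f sf; first exact: smooth_class_continuous.
split=> [|i]; first exact: smooth_class_continuous.
have [g sg dg] := smooth_class_derive sf i; split=> [x|].
  by have [] := dg x.
rewrite (_ : partial i f = g); first exact: IHk.
by apply/funext => x; have [_] := dg x.
Qed.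

Lemma smooth_class_prod (I : Type) (s : seq I) (F : I -> X -> R) :
  (forall i, smooth_class (F i)) -> smooth_class (fun x => \prod_(i <- s) F i x).
Proof.
move=> sF; elim: s => [|i s IHs].
  by under eq_fun do rewrite big_nil; exact: smooth_cst.
by under eq_fun do rewrite big_cons; exact: smooth_mul.
Qed.

(** The measurable structure is generated by the coordinates, so an open set is
    written as a countable union of rational cubes. *)
Lemma open_rV_measurable (O : set X) : open O -> measurable O.
Proof.
move=> oO; pose c (q : 'rV[rat]_d) : X := map_mx ratr q.
pose B (p : 'rV[rat]_d * nat) : set X :=
  rectangle (fun i => ball (c p.1 ord0 i) p.2.+1%:R^-1).
pose F n : set X := if unpickle n is Some p then
  (if `[< B p `<=` O >] then B p else set0) else set0.
rewrite (_ : O = \bigcup_n F n).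
  apply: bigcupT_measurable => n; rewrite /F; case: unpickle => // p.
  case: ifP => // _; apply: measurable_rectangle => i.
  by apply: open_measurable; exact: ball_open.
apply/seteqP; split=> [x Ox|x [n _]]; last first.
  by rewrite /F; case: unpickle => // p; case: ifPn => // /asboolP; exact.
have /nbhs_ballP[e /= e0 eO] := open_nbhs_nbhs (conj oO Ox).
pose k := Num.truncn (e^-1 *+ 2).
have k0 : (0 : R) < k.+1%:R^-1 by rewrite invr_gt0.
have ke : (k.+1%:R^-1 : R) < e / 2.
  rewrite -[e / 2]invrK ltf_pV2 ?posrE ?invr_gt0 ?divr_gt0//.
  by rewrite invfM invrK mulr_natr; exact: truncnS_gt.
have /choice[q qx] (i : 'I_d) : exists q : rat, `|ratr q - x ord0 i| < k.+1%:R^-1.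
  have /rat_in_itvoo[q] : x ord0 i - k.+1%:R^-1 < x ord0 i + k.+1%:R^-1.
    by rewrite ltrBlDr -addrA ltrDl addr_gt0.
  by rewrite in_itv/= => qi; exists q; rewrite ltr_distl.
exists (pickle (\row_i q i, k)) => //; rewrite /F pickleK ifT.
  by move=> i; rewrite /ball/= !mxE; exact: qx.
apply/asboolP => y By; apply: eO; rewrite -ball_normE/=.
apply/normr_rV_ltP => // i; rewrite !mxE.
have := By i; rewrite /ball/= !mxE => qy.
rewrite (_ : _ - _ = (ratr (q i) - y ord0 i) - (ratr (q i) - x ord0 i)); last by ring.
rewrite (le_lt_trans (ler_normB _ _))// (lt_trans (ltrD qy (qx i)))//.
  by rewrite (lt_le_trans (ltrD ke ke))// -splitr.
Qed.

Lemma continuous_rV_measurable (f : X -> R) : continuous f ->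
  measurable_fun setT f.
Proof.
move=> /continuousP cf; apply: (measurability _ (RGenOpens.measurableE R)).
move=> _ [_ [a [b ->] <-]]; rewrite setTI; apply: open_rV_measurable.
exact/cf/interval_open.
Qed.

(** Support in a cube, the form in which compact supports are used below. *)
Definition compactly_supported (f : X -> R) :=
  exists2 r : R, 0 <= r & forall x, r < `|x| -> f x = 0.

Lemma compact_cube (r : R) : compact [set x : X | `|x| <= r].
Proof.
have [r0|r0] := ltP r 0; first by rewrite closed_cube_lt0//; exact: compact0.
rewrite closed_cubeE//; apply: (@rV_compact _ _ (fun=> `[- r, r]%classic)) => i.
exact: segment_compact.
Qed.

Lemma continuous_compact_bounded (f : X -> R) : continuous f ->
  compactly_supported f -> exists2 M : R, 0 < M & forall x, `|f x| <= M.
Proof.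
move=> cf [r r0 fr].
have := continuous_compact (continuous_subspaceT cf) (@compact_cube r).
move=> /compact_bounded [M [_ HM]]; exists (Num.max 0 M + 1) => [|x].
  by rewrite ltr_wpDl// le_max lexx.
have [xr|xr] := leP `|x| r; last first.
  by rewrite fr// normr0 addr_ge0// le_max lexx.
apply: HM; last by exists x.
by rewrite ltr_pwDr// le_max lexx orbT.
Qed.

Lemma compactly_supportedP (f : X -> R) :
  compactly_supported f <-> compact (closure [set x | f x != 0]).
Proof.
split=> [[r r0 fr]|/compact_bounded[M [_ HM]]].
  apply: (subclosed_compact (@closed_closure _ _) (@compact_cube r)).
  have clK := compact_closed (@norm_hausdorff _ _) (@compact_cube r).
  move/closure_id: clK => ->; apply: closureS => x /= fx.
  by rewrite leNgt; apply: contra fx => /fr ->.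
exists (Num.max 0 M + 1) => [|x xM]; first by rewrite addr_ge0// le_max lexx.
apply: contrapT => /eqP fx; move: xM; apply/negP; rewrite -leNgt.
apply: HM; last exact: subset_closure.
by rewrite ltr_pwDr// le_max lexx orbT.
Qed.

Lemma test_function_continuous (f : X -> R) : test_function f -> continuous f.
Proof. by move=> [/(_ 0%N)]. Qed.

Lemma test_function_supported (f : X -> R) : test_function f -> compactly_supported f.
Proof. by move=> [_ /compactly_supportedP]. Qed.

Lemma test_function_derivable (f : X -> R) i x : test_function f -> derivable f x (dir i).
Proof. by move=> [/(_ 1%N)/= [_ /(_ i)[]]]. Qed.

Lemma partial_test_function_continuous (f : X -> R) i : test_function f ->
  continuous (partial i f).
Proof. by move=> [/(_ 1%N)/= [_ /(_ i)[]]]. Qed.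

Lemma partial_supported (f : X -> R) i : compactly_supported f ->
  compactly_supported (partial i f).
Proof.
move=> [r r0 fr]; exists r => // x rx; rewrite /partial.
rewrite (near_eq_derive (g := cst 0)) ?derive_cst//.
near=> y; apply: fr; near: y.
by apply: (cvgr_gt `|x|) => //; exact: norm_continuous.
Unshelve. all: by end_near. Qed.

(** In each coordinate one factor vanishes below [- r] and the other above [r]. *)
Definition smooth_bump (r : R) (x : X) : R :=
  \prod_(i < d) (flat_exp 0 (r + 1 * x ord0 i) * flat_exp 0 (r + (-1) * x ord0 i)).

Lemma smooth_bump_ge0 r x : 0 <= smooth_bump r x.
Proof. by apply: prodr_ge0 => i _; rewrite mulr_ge0// flat_exp_ge0. Qed.

Lemma smooth_bump_gt0 r x : `|x| < r -> 0 < smooth_bump r x.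
Proof.
move=> xr; apply: prodr_gt0 => i _.
have := le_lt_trans (normr_coord_le x i) xr; rewrite ltr_norml => /andP[? ?].
by rewrite mulr_gt0// flat_exp_gt0//; lra.
Qed.

Lemma smooth_bump_eq0 r x : 0 < r -> r <= `|x| -> smooth_bump r x = 0.
Proof.
move=> r0 rx; apply/eqP; apply: contraTT rx; rewrite -ltNge => bx.
apply/normr_rV_ltP => // i; rewrite ltNge; apply/negP => rxi; move/eqP: bx; apply.
rewrite /smooth_bump (bigD1 i)//=.
have [x0|x0] := leP 0 (x ord0 i).
  rewrite (flat_exp_le0 0 (_ : r + (-1) * x ord0 i <= 0)) ?mulr0 ?mul0r//.
  by move: rxi; rewrite ger0_norm//; lra.
rewrite (flat_exp_le0 0 (_ : r + 1 * x ord0 i <= 0)) ?mul0r//.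
by move: rxi; rewrite ltr0_norm//; lra.
Qed.

Lemma smooth_bump_test_function r : 0 < r -> test_function (smooth_bump r).
Proof.
move=> r0; split=> [k|].
  apply: smooth_class_Ck; apply: smooth_class_prod => i.
  by apply: smooth_mul; exact: smooth_flat.
apply/compactly_supportedP; exists r => [|x rx]; first exact: ltW.
exact/smooth_bump_eq0/ltW.
Qed.


(** Differentiability is known along lines, so the chain rule is applied on the
    line through the point. *)
Let is_derive_affine (f : X -> R) i (c : X) (s : R) (x : X) :
  derivable f (c + s *: x) (dir i) ->
  is_derive x (dir i) (fun y => f (c + s *: y)) (s * partial i f (c + s *: x)).
Proof.
move=> df; apply/is_derive_line.
pose l (h : R) := f (h *: dir i + (c + s *: x)).
have H : is_derive (c + s *: x) (dir i) f (partial i f (c + s *: x)) by split.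
have dl : is_derive (0 : R) 1 l (partial i f (c + s *: x)).
  exact: (is_derive_line _ _ _ _).1 H.
have dg : is_derive (0 : R) 1 (fun h : R => s * h) s.
  by apply: is_derive_eq; rewrite [LHS]mulr1.
rewrite -{1}(mulr0 s) in dl.
rewrite mulrC (_ : (fun h => _) = l \o (fun h => s * h)); last first.
  by apply/funext => h; rewrite /l /= scalerDr scalerA addrCA.
exact: is_derive_chain.
Qed.

Let Ck_affine k (f : X -> R) (a : R) (c : X) (s : R) : Ck k f ->
  Ck k (fun x : X => a * f (c + s *: x)).
Proof.
have cc (g : X -> R) b : continuous g -> continuous (fun x : X => b * g (c + s *: x)).
  move=> cg x; apply: (@continuousM _ _ (cst b) (fun x : X => g (c + s *: x))).
    exact: cst_continuous.
  apply: (@continuous_comp _ _ _ (fun x : X => c + s *: x)); last exact: cg.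
  apply: (@continuousD _ _ _ (cst c) (fun x : X => s *: x)).
    exact: cst_continuous.
  exact: scaler_continuous.
elim: k f a => [|k IHk] f a /=; first exact: cc.
move=> [cf df]; split=> [|i]; first exact: cc.
have [dfi Cki] := df i.
have D x := is_deriveZ a (is_derive_affine (dfi (c + s *: x))).
split=> [x|]; first by have [] := D x.
rewrite (_ : partial i _ = fun x : X => (a * s) * partial i f (c + s *: x)).
  exact: IHk.
by apply/funext => x; have [_] := D x; rewrite -mulrA; exact.
Qed.

Lemma partial_affine (f : X -> R) i (c : X) (s : R) (x : X) : test_function f ->
  partial i (fun y : X => f (c + s *: y)) x = s * partial i f (c + s *: x).
Proof.
by move=> tf; have [] := is_derive_affine (@test_function_derivable f i (c + s *: x) tf).
Qed.

Lemma test_function_affine (f : X -> R) (c : X) (s : R) : s != 0 ->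
  test_function f -> test_function (fun x : X => f (c + s *: x)).
Proof.
move=> s0 tf; split=> [k|].
  rewrite (_ : (fun x => _) = fun x : X => 1 * f (c + s *: x)).
    by apply: Ck_affine; case: tf.
  by apply/funext => x; rewrite mul1r.
have [r r0 fr] := test_function_supported tf.
apply/compactly_supportedP; exists ((r + `|c|) / `|s|) => [|x].
  by rewrite divr_ge0// addr_ge0.
rewrite ltr_pdivrMr ?normr_gt0// mulrC -normrZ => xr; apply: fr.
have := ler_normB (c + s *: x) c; rewrite addrAC subrr add0r.
by move=> /(lt_le_trans xr); rewrite ltrD2r.
Qed.

End test_functions.

(** * Correlations over a cell *)

Section real_integrals.
Context {R : realType} {d : nat}.
Local Notation X := 'rV[R]_d.
Local Notation mu := (lebesgue_rV (R := R) (n := d)).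

Lemma Rintegral_sum dd (T : measurableType dd) (m : {measure set T -> \bar R})
    (D : set T) (I : Type) (s : seq I) (f : I -> T -> R) : measurable D ->
  (forall i, m.-integrable D (EFin \o f i)) ->
  \int[m]_(x in D) (\sum_(i <- s) f i x) = \sum_(i <- s) \int[m]_(x in D) f i x.
Proof.
move=> mD fi; elim: s => [|i s IHs].
  by rewrite big_nil; under eq_Rintegral do rewrite big_nil; rewrite Rintegral_cst// mul0r.
rewrite big_cons -IHs -RintegralD//.
  by apply: eq_Rintegral => x _; rewrite big_cons.
rewrite (_ : _ \o _ = fun x => (\sum_(i <- s) (f i x)%:E)%E).
  by apply: integrable_sum => // j _; exact: fi.
by apply/funext => x; rewrite /= sumEFin.
Qed.

Lemma Rintegral_translation (c : X) (f : X -> R) : measurable_fun setT f ->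
  \int[mu]_x f (x + c) = \int[mu]_x f x.
Proof.
move=> mf; congr fine; rewrite integralE [RHS]integralE.
have mfE : measurable_fun setT (EFin \o f) by exact/measurable_EFinP.
congr (_ - _)%E.
  rewrite -[RHS](ge0_integral_translation c)//; last exact: measurable_funepos.
  by apply: eq_integral => x _; rewrite !funeposE.
rewrite -[RHS](ge0_integral_translation c)//; last exact: measurable_funeneg.
by apply: eq_integral => x _; rewrite !funenegE.
Qed.

Lemma Rintegral_reflection (c : X) (f : X -> R) : measurable_fun setT f ->
  \int[mu]_x f (c - x) = \int[mu]_x f x.
Proof.
move=> mf; congr fine; rewrite integralE [RHS]integralE.
have mfE : measurable_fun setT (EFin \o f) by exact/measurable_EFinP.
congr (_ - _)%E.
  rewrite -[RHS](ge0_integral_reflection c)//; last exact: measurable_funepos.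
  by apply: eq_integral => x _; rewrite !funeposE.
rewrite -[RHS](ge0_integral_reflection c)//; last exact: measurable_funeneg.
by apply: eq_integral => x _; rewrite !funenegE.
Qed.

(** [k] is bounded with support in a cube, on which [`|b| <= 1 + b ^+ 2]. *)
Lemma L2loc_integrable (b k : X -> R) : L2loc b -> continuous k ->
  compactly_supported k -> mu.-integrable setT (EFin \o (fun x => b x * k x)).
Proof.
move=> [mb boo] ck sk; have [M M0 kM] := continuous_compact_bounded ck sk.
have [r r0 kr] := sk; have mk := continuous_rV_measurable ck.
pose Q := [set x : X | `|x| <= r]; have mQ : measurable Q := measurable_cube r.
apply: (@le_integrable _ _ _ _ _ measurableT _
  ((fun x => M%:E * (1 + (b x ^+ 2)%:E))%E \_ Q)).
- by apply/measurable_EFinP; exact: measurable_funM.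
- move=> x _; rewrite patchE; case: ifPn => [_|xQ]; last first.
    rewrite /= kr ?mulr0 ?normr0// ltNge.
    by apply: contraNN xQ => xr; exact: mem_set.
  rewrite -EFinD -EFinM /= lee_fin normrM mulrC.
  rewrite [leRHS]ger0_norm ?mulr_ge0 ?addr_ge0 ?sqr_ge0//; last exact: ltW.
  apply: ler_pM => //.
  rewrite -(real_normK (num_real (b x))); have := sqr_ge0 (`|b x| - 1).
  by have := normr_ge0 (b x); nra.
apply: (integrable_mkcond _ mQ).1; apply: integrableZl => //.
apply: integrableD => //.
  apply/integrableP; split => //; under eq_integral do rewrite abse1.
  by rewrite integral_cst// mul1e; exact: lebesgue_rV_cube_lty.
apply/integrableP; split.
  by apply: measurable_funS (measurable_sq mb).
under eq_integral do rewrite gee0_abs ?lee_fin ?sqr_ge0//.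
exact: boo.
Qed.

Lemma L2loc_translation (b : X -> R) (c : X) : L2loc b ->
  L2loc (fun x : X => b (x + c)).
Proof.
move=> [mb boo]; split=> [|r]; first exact: measurable_shift.
apply: le_lt_trans (boo (r + `|c|)).
rewrite integral_mkcond [leRHS]integral_mkcond.
have mQ s : measurable_fun setT
    ((fun x => ((b x) ^+ 2)%:E) \_ [set x : X | `|x| <= s]).
  apply/(measurable_restrictT _ (measurable_cube s)).
  by apply: measurable_funS (measurable_sq mb).
rewrite -[leRHS](ge0_integral_translation c)//; last first.
  by move=> x; rewrite patchE; case: ifP => // _; rewrite lee_fin sqr_ge0.
apply: ge0_le_integral => //.
- by move=> x _; rewrite patchE; case: ifP => // _; rewrite lee_fin sqr_ge0.
- apply/(measurable_restrictT _ (measurable_cube r)).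
  by apply: measurable_funS (measurable_sq (measurable_shift c mb)).
- exact: (measurableT_comp (mQ _) (measurable_translation c)).
move=> x _; rewrite !patchE; case: ifPn => [/set_mem/= xr|_]; last first.
  by case: ifP => // _; rewrite lee_fin sqr_ge0.
by rewrite mem_set//= (le_trans (ler_normD _ _))// lerD2r.
Qed.

End real_integrals.

Section cell_integrals.
Context {R : realType} {d : nat} (A : 'M[R]_d) (hA : A \in unitmx).
Context (V : set 'rV[R]_d) (hV : unit_cell A V).
Local Notation X := 'rV[R]_d.
Local Notation mu := (lebesgue_rV (R := R) (n := d)).
Let mV : measurable V := unit_cell_measurable hV.

Definition cell_sqnorm (a : X -> R) : \bar R := (\int[mu]_(x in V) ((a x) ^+ 2)%:E)%E.

Lemma L2per_measurable (a : X -> R) : L2per A a -> measurable_fun setT a.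
Proof. by case=> -[]. Qed.

Lemma L2per_translation (a : X -> R) (c : X) : L2per A a ->
  measurable_fun setT (fun x : X => a (x + c)).
Proof. by move=> /L2per_measurable; exact: measurable_shift. Qed.

Lemma cell_sqnorm_lty (a : X -> R) : L2per A a -> (cell_sqnorm a < +oo)%E.
Proof.
move=> [[ma aoo] pa]; apply: (ge0_integral_cell_lty hA hV) => //.
- exact: measurable_sq.
- by move=> x; rewrite lee_fin sqr_ge0.
- by move=> r lr x; rewrite pa.
Qed.

Lemma cell_sqnorm_ge0 a : (0 <= cell_sqnorm a)%E.
Proof. by apply: integral_ge0 => x _; rewrite lee_fin sqr_ge0. Qed.

Lemma cell_sqnorm_translation (a : X -> R) (y : X) : L2per A a ->
  cell_sqnorm (fun x : X => a (x + y)) = cell_sqnorm a.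
Proof.
move=> [[ma aoo] pa]; rewrite /cell_sqnorm.
rewrite -(ge0_integral_cell_translation hA hV y (f := fun x => ((a x) ^+ 2)%:E))//.
- exact: measurable_sq.
- by move=> x; rewrite lee_fin sqr_ge0.
- by move=> r lr x; rewrite pa.
Qed.

(** Young's inequality. *)
Lemma cell_product_le (a b : X -> R) (e : R) : 0 < e ->
  measurable_fun setT a -> measurable_fun setT b ->
  (\int[mu]_(x in V) (`|a x * b x|)%:E <=
   e%:E * cell_sqnorm a + e^-1%:E * cell_sqnorm b)%E.
Proof.
move=> e0 ma mb.
have mSa : measurable_fun V (fun x => ((a x) ^+ 2)%:E).
  by apply: measurable_funS (measurable_sq ma).
have mSb : measurable_fun V (fun x => ((b x) ^+ 2)%:E).
  by apply: measurable_funS (measurable_sq mb).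
have ei0 : 0 < e^-1 by rewrite invr_gt0.
rewrite -!ge0_integralZl//; try by
  [move=> x _; rewrite lee_fin sqr_ge0|rewrite lee_fin ltW].
rewrite -ge0_integralD//; first last.
- exact: measurable_funeM.
- by move=> x _; rewrite -EFinM lee_fin mulr_ge0 ?sqr_ge0 ?ltW.
- exact: measurable_funeM.
- by move=> x _; rewrite -EFinM lee_fin mulr_ge0 ?sqr_ge0 ?ltW.
apply: ge0_le_integral => //.
- apply/measurable_EFinP; apply: measurableT_comp => //.
  by apply: (measurable_funS measurableT) => //; exact: measurable_funM.
- by apply: emeasurable_funD; exact: measurable_funeM.
move=> x _; rewrite -!EFinM -EFinD lee_fin normrM.
rewrite -(real_normK (num_real (a x))) -(real_normK (num_real (b x))).
set u := `|a x|; set v := `|b x|.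
have u0 : 0 <= u by exact: normr_ge0.
have v0 : 0 <= v by exact: normr_ge0.
have : 0 <= e^-1 * (e * u - v) ^+ 2 by rewrite mulr_ge0 ?sqr_ge0 ?ltW.
have -> : e^-1 * (e * u - v) ^+ 2 = e * u ^+ 2 + e^-1 * v ^+ 2 - 2 * (u * v).
  by field; rewrite gt_eqF.
have := mulr_ge0 u0 v0; lra.
Qed.

Lemma cell_product_integrable (a b : X -> R) (y : X) : L2per A a -> L2per A b ->
  mu.-integrable V (EFin \o (fun x : X => a x * b (x + y))).
Proof.
move=> pa pb; have ma := L2per_measurable pa; have mb := L2per_translation y pb.
apply/integrableP; split.
  by apply/measurable_EFinP; apply: measurable_funS (measurable_funM ma mb).
apply: (le_lt_trans (cell_product_le ltr01 ma mb)).
rewrite invr1 !mul1e cell_sqnorm_translation// lte_add_pinfty//; exact: cell_sqnorm_lty.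
Qed.

Lemma Rintegral_cell_translation (f : X -> R) (y : X) :
  measurable_fun setT f -> lattice_periodic A f ->
  \int[mu]_(x in V) f (x + y) = \int[mu]_(x in V) f x.
Proof.
move=> mf pf; congr fine.
apply: (integral_cell_translation hA hV y (f := EFin \o f)).
  exact/measurable_EFinP.
by move=> r lr x /=; rewrite pf.
Qed.

(** For periodic [a] and [b], a function of the displacement [y] between the two
    factors, which is itself periodic. *)
Definition correlation (a b : X -> R) (y : X) : R :=
  \int[mu]_(x in V) (a x * b (x + y)).

(** The periodic integrand may be translated by [y]. *)
Lemma correlationN (a b : X -> R) (y : X) : L2per A a -> L2per A b ->
  correlation a b (- y) = correlation b a y.
Proof.
move=> pa pb; have ma := L2per_measurable pa; have mb := L2per_measurable pb.
rewrite /correlation -(@Rintegral_cell_translation _ y).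
- by apply: eq_Rintegral => x _; rewrite addrK mulrC.
- by apply: measurable_funM => //; exact: measurable_shift.
- move=> r lr x; case: pa pb => [_ pa] [_ pb].
  by rewrite [x + r - y]addrAC (pa _ lr) (pb _ lr).
Qed.

Let measurable_conv (b : X -> R) : measurable_fun setT b ->
  measurable_fun setT (fun p : X * X => b (p.1 + p.2)).
Proof.
move=> mb; apply: (measurableT_comp mb).
apply: (measurable_fun_rVP (T := (X * X)%type)) => i.
rewrite (_ : _ \o _ = (fun p : X * X => rV_coord i p.1 + rV_coord i p.2)).
  by apply: measurable_funD; apply: measurableT_comp => //; exact: measurable_rV_coord.
by apply/funext => p /=; rewrite /rV_coord !mxE.
Qed.

Let F (a b k : X -> R) (p : X * X) : R :=
  \1_V p.1 * a p.1 * b (p.1 + p.2) * k p.2.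

Let measurable_F (a b k : X -> R) : measurable_fun setT a ->
  measurable_fun setT b -> measurable_fun setT k ->
  measurable_fun setT (F a b k).
Proof.
move=> ma mb mk; apply: measurable_funM; last exact: measurableT_comp.
apply: measurable_funM; last exact: measurable_conv.
by apply: measurable_funM; apply: measurableT_comp => //; exact: measurable_indic.
Qed.

Let fubini_hyp (a b k : X -> R) : L2per A a -> L2per A b -> continuous k ->
  compactly_supported k -> (mu \x mu)%E.-integrable setT (EFin \o F a b k).
Proof.
move=> pa pb ck sk; have ma := L2per_measurable pa; have mb := L2per_measurable pb.
have mk := continuous_rV_measurable ck.
have mFE : measurable_fun setT (EFin \o F a b k).
  by apply/measurable_EFinP; exact: measurable_F.
apply/integrable21ltyP => //.
have ik : mu.-integrable setT (EFin \o (fun x => 1 * k x)).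
  apply: L2loc_integrable => //; split=> // r.
  under eq_integral do rewrite expr1n.
  rewrite integral_cst ?mul1e; last exact: measurable_cube.
  exact: lebesgue_rV_cube_lty.
pose C := (cell_sqnorm a + cell_sqnorm b)%E.
have Coo : (C < +oo)%E by rewrite lte_add_pinfty// cell_sqnorm_lty.
have C0 : (0 <= C)%E by rewrite adde_ge0// cell_sqnorm_ge0.
apply: (@le_lt_trans _ _ (\int[mu]_y (C * (`|k y|)%:E))%E).
  apply: ge0_le_integral => //.
  - by move=> y _; exact: integral_ge0.
  - apply: (measurable_fun_fubini_tonelli_G (abse \o (EFin \o F a b k))) => //.
      exact: measurableT_comp.
    by move=> p; exact: abse_ge0.
  - by apply: measurable_funeM; apply/measurable_EFinP; exact: measurableT_comp.
  move=> y _.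
  rewrite (_ : (\int[mu]_x _)%E =
      (\int[mu]_(x in V) (`|a x * b (x + y)%R|)%:E * (`|k y|)%:E)%E); last first.
    rewrite -ge0_integralZr//; last first.
      apply/measurable_EFinP; apply: measurableT_comp => //.
      apply: (measurable_funS measurableT) => //; apply: measurable_funM => //.
      exact: measurable_shift.
    rewrite [RHS]integral_mkcond; apply: eq_integral => x _.
    rewrite patchE /F /= indicE; case: ifP => _; last by rewrite !mul0r normr0.
    by rewrite mul1r -EFinM normrM.
  apply: lee_wpmul2r; first by rewrite lee_fin.
  apply: (le_trans (cell_product_le ltr01 ma (L2per_translation y pb))).
  by rewrite invr1 !mul1e cell_sqnorm_translation.
rewrite ge0_integralZl//; last first.
  by apply/measurable_EFinP; exact: measurableT_comp.
rewrite lte_mul_pinfty// ?ge0_fin_numE//.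
move/integrableP: ik => [_]; apply: le_lt_trans.
by apply: ge0_le_integral => //= [||x _]; rewrite ?mul1r//;
  apply/measurable_EFinP; apply: measurableT_comp => //; apply: measurable_funM.
Qed.

(** Fubini for [a x * b (x + y) * k y] with [x] in the cell: in the mean square
    [b (. + y)] has the size of [b], so the double integral converges
    absolutely as soon as [k] is integrable.  The inner integrals exist for
    every value of the outer variable, not only for almost every one. *)
Lemma integral_correlation (a b k : X -> R) : L2per A a -> L2per A b ->
  continuous k -> compactly_supported k ->
  [/\ mu.-integrable setT (EFin \o (fun y => correlation a b y * k y)),
      mu.-integrable V (EFin \o (fun x => a x * \int[mu]_y (b (x + y) * k y))) &
      \int[mu]_(x in V) (a x * \int[mu]_y (b (x + y) * k y)) =
      \int[mu]_y (correlation a b y * k y)].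
Proof.
move=> pa pb ck sk; have iF := fubini_hyp pa pb ck sk.
have ma := L2per_measurable pa; have mb := L2per_measurable pb.
have mk := continuous_rV_measurable ck.
have GE y : (\int[mu]_x (F a b k (x, y))%:E = (correlation a b y * k y)%:E)%E.
  transitivity (\int[mu]_(x in V) ((k y)%:E * (a x * b (x + y)%R)%:E))%E.
    rewrite [RHS]integral_mkcond; apply: eq_integral => x _.
    rewrite patchE /F /= indicE; case: ifP => _; last by rewrite !mul0r.
    by rewrite mul1r -EFinM mulrC.
  rewrite integralZl//; last exact: cell_product_integrable.
  rewrite mulrC EFinM; congr (_ * _)%E; rewrite fineK//.
  by apply: integrable_fin_num => //; exact: cell_product_integrable.
have FE x : (\int[mu]_y (F a b k (x, y))%:E =
    (\1_V x * (a x * \int[mu]_y (b (x + y) * k y)))%:E)%E.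
  have ib : mu.-integrable setT (EFin \o (fun y => b (x + y) * k y)).
    apply: L2loc_integrable => //.
    rewrite (_ : (fun y => _) = fun y : X => b (y + x)).
      by apply: L2loc_translation; case: pb.
    by apply/funext => y; rewrite addrC.
  rewrite mulrA EFinM fineK; last exact: integrable_fin_num.
  rewrite -integralZl//; apply: eq_integral => y _.
  by rewrite /F /= -EFinM mulrA.
split.
  have mG := measurable_fubini_G iF; have mF := measurable_int _ iF.
  apply: (@eq_integrable _ _ _ _ _ measurableT (fubini_G mu (EFin \o F a b k))).
    by move=> y _; rewrite /fubini_G /= GE.
  apply/integrableP; split=> //.
  have := (@integrable21ltyP _ _ _ _ _ mu mu _ mF).1 iF.
  apply: le_lt_trans; apply: ge0_le_integral => //.
  - exact: measurableT_comp.
  - apply: (measurable_fun_fubini_tonelli_G (abse \o (EFin \o F a b k))) => //.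
      exact: measurableT_comp.
    by move=> p; exact: abse_ge0.
  - move=> y _; apply: le_abse_integral => //.
    exact: measurable_fun_pair1.
  apply: (integrable_mkcond _ mV).2.
  apply: (@eq_integrable _ _ _ _ _ measurableT (fubini_F mu (EFin \o F a b k))).
    move=> x _; rewrite /fubini_F /= FE patchE indicE.
    by case: ifP => _; rewrite ?mul1r ?mul0r.
  exact: integrable_fubini_F iF.
have := Fubini iF; rewrite /=.
rewrite (eq_integral _ _ (fun x _ => FE x)) (eq_integral _ _ (fun y _ => GE y)) => E.
rewrite /Rintegral -E; congr fine.
rewrite [LHS]integral_mkcond; apply: eq_integral => x _.
by rewrite patchE indicE; case: ifP => _; rewrite ?mul1r ?mul0r.
Qed.

End cell_integrals.

Section correlations.
Context {R : realType} {d : nat} (A : 'M[R]_d) (hA : A \in unitmx).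
Context (V : set 'rV[R]_d) (hV : unit_cell A V).
Local Notation X := 'rV[R]_d.
Local Notation mu := (lebesgue_rV (R := R) (n := d)).
Let mV : measurable V := unit_cell_measurable hV.
Local Notation correlation := (correlation V).
Local Notation cell_sqnorm := (cell_sqnorm V).

(** Young's inequality bounds the difference by the mean square of [a], with a
    small factor, and that of [b (. + y) - b], which is controlled on a cube
    that covers the cell. *)
Lemma correlation_continuous (a b : X -> R) (e : R) :
  L2per A a -> L2per A b -> 0 < e ->
  exists2 D : R, 0 < D & forall y : X, `|y| < D ->
    `|correlation a b y - correlation a b 0| <= e.
Proof.
move=> pa pb e0; have ma := L2per_measurable pa; have mb := L2per_measurable pb.
have [r cQ] := covering_cube hA.
have ca : cell_sqnorm a \is a fin_num.
  by rewrite ge0_fin_numE ?cell_sqnorm_ge0// (cell_sqnorm_lty hA hV pa).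
pose s := fine (cell_sqnorm a).
have s0 : 0 <= s by rewrite fine_ge0// cell_sqnorm_ge0.
(* the weight in Young's inequality: [h * s <= e / 2], and the 1 avoids a zero
   denominator *)
pose h := e / (2 * (s + 1)).
have h0 : 0 < h by rewrite divr_gt0// mulr_gt0// ltr_wpDl.
have [D D0 HD] := L2loc_translation_continuous r (proj1 pb) (divr_gt0 (mulr_gt0 h0 e0) (ltr0n R 2)).
exists D => // y yD; pose u (x : X) := b (x + y) - b x.
have mu' : measurable_fun setT u.
  by apply: measurable_funB => //; exact: measurable_shift.
have Nu : (cell_sqnorm u <= (h * e / 2)%:E)%E.
  apply: le_trans (HD y yD).
  apply: (ge0_integral_packing_covering hA mV (unit_cell_packing hV)) => //.
  - exact: measurable_cube.
  - exact: measurable_sq.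
  - by move=> x; rewrite lee_fin sqr_ge0.
  - by move=> l ll x; rewrite /u addrAC !(proj2 pb _ ll).
have corE z : correlation a b z = \int[mu]_(x in V) (a x * b (x + z)) by [].
have -> : correlation a b y - correlation a b 0 = \int[mu]_(x in V) (a x * u x).
  rewrite !corE -RintegralB//; [|exact: (cell_product_integrable hA hV)|exact: (cell_product_integrable hA hV)].
  by apply: eq_Rintegral => x _; rewrite addr0 /u mulrBr.
have iu : mu.-integrable V (EFin \o (fun x => a x * u x)).
  rewrite (_ : _ \o _ = (EFin \o (fun x : X => a x * b (x + y))%R) \-
      (EFin \o (fun x : X => a x * b (x + 0))%R))%E.
    by apply: integrableB => //; exact: (cell_product_integrable hA hV).
  by apply/funext => x; rewrite /= addr0 /u mulrBr.
rewrite -lee_fin EFin_normr_Rintegral//.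
apply: (le_trans (le_abse_integral _ _ _)) => //; first exact: measurable_int iu.
apply: (le_trans (cell_product_le hV h0 ma mu')).
apply: (@le_trans _ _ (h%:E * s%:E + h^-1%:E * (h * e / 2)%:E)%E).
  rewrite -(fineK ca) leeD2l// lee_wpmul2l//.
  by rewrite lee_fin invr_ge0 ltW.
rewrite -!EFinM -EFinD lee_fin (_ : h^-1 * (h * e / 2) = e / 2); last first.
  by field; rewrite gt_eqF.
have : h * s <= e / 2; last by lra.
rewrite /h -mulrA -[leRHS]mulr1 invfM -!mulrA ler_pM2l// ler_pM2l ?invr_gt0//.
by rewrite mulrC ler_pdivrMr ?mul1r ?lerDl// ltr_wpDl.
Qed.

Lemma continuous_integrable (k : X -> R) : continuous k ->
  compactly_supported k -> mu.-integrable setT (EFin \o k).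
Proof.
move=> ck sk.
have := @L2loc_integrable _ _ (cst 1) k _ ck sk.
rewrite (_ : (fun x => _) = k); last by apply/funext => x; rewrite /= mul1r.
apply; split=> // r.
under eq_integral do rewrite expr1n.
rewrite integral_cst ?mul1e; last exact: measurable_cube.
exact: lebesgue_rV_cube_lty.
Qed.

Lemma smooth_bump_integral_gt0 (r : R) : 0 < r -> 0 < \int[mu]_x smooth_bump r x.
Proof.
move=> r0; have tb := smooth_bump_test_function (d := d) r0.
have ib := continuous_integrable (test_function_continuous tb) (test_function_supported tb).
rewrite lt0r Rintegral_ge0 ?andbT => [|x _]; last exact: smooth_bump_ge0.
apply/eqP => b0.
have : (\int[mu]_x `|(smooth_bump r x)%:E| = 0)%E.
  rewrite -[RHS](congr1 EFin b0) fineK; last exact: integrable_fin_num.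
  by apply: eq_integral => x _; rewrite gee0_abs// lee_fin smooth_bump_ge0.
move=> /(ae_eq_integral_abs _ measurableT (measurable_int _ ib)) [N [mN N0 bN]].
have : mu (rectangle (fun=> `[- (r / 2), r / 2]%classic)) = 0%E.
  apply: (subset_measure0 _ mN) => //.
    by apply: measurable_rectangle => i; exact: measurable_itv.
  move=> x xr; apply: bN => /= /(_ I) [] /eqP; rewrite gt_eqF// smooth_bump_gt0//.
  apply: (@le_lt_trans _ _ (r / 2)); last by lra.
  apply/normr_rV_leP => [|i]; first by lra.
  by have := xr i; rewrite /= in_itv/= ler_norml.
rewrite lebesgue_rV_box => [|i]; last exact: measurable_itv.
rewrite (eq_bigr (fun=> r%:E)) => [|i _]; last first.
  rewrite lebesgue_measure_itv/= lte_fin ifT; last by lra.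
  by rewrite -EFinB opprK -splitr.
rewrite prodEFin => -[] /eqP; apply/negP.
by apply/prodf_neq0 => i _; rewrite gt_eqF.
Qed.

(** The sum of correlations is a continuous function at 0; were it not zero
    there, it would keep its sign on a small cube and its integral against a
    bump supported in that cube would not vanish. *)
Lemma mollifier_eq0 (I : finType) (a b : I -> X -> R) :
  (forall i, L2per A (a i)) -> (forall i, L2per A (b i)) ->
  (forall f, test_function f ->
    \sum_i \int[mu]_y (correlation (a i) (b i) y * f y) = 0) ->
  \sum_i correlation (a i) (b i) 0 = 0.
Proof.
move=> pa pb H; pose g y := \sum_i correlation (a i) (b i) y.
have cg (e : R) : 0 < e -> exists2 D : R, 0 < D &
    forall y : X, `|y| < D -> `|g y - g 0| <= e.
  (* the successor covers the case of an empty index type *)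
  move=> e0; have en0 : 0 < e / #|I|.+1%:R by rewrite divr_gt0.
  have /choice[D HD] (i : I) : exists D : R, 0 < D /\ forall y : X, `|y| < D ->
      `|correlation (a i) (b i) y - correlation (a i) (b i) 0| <= e / #|I|.+1%:R.
    by have [D D0 HD] := correlation_continuous (pa i) (pb i) en0; exists D.
  exists (\big[Num.min/1]_i D i).
    by apply: lt_bigmin => // i _; have [] := HD i.
  move=> y yD; rewrite /g -sumrB (le_trans (ler_norm_sum _ _ _))//.
  apply: (@le_trans _ _ (\sum_(i : I) e / #|I|.+1%:R)).
    apply: ler_sum => i _; have [_] := HD i; apply.
    by apply: (lt_le_trans yD); exact: bigmin_le.
  rewrite sumr_const -[leLHS]mulr_natr -mulrA ler_piMr//; first exact: ltW.
  by rewrite ler_pdivrMl// mulr1 ler_nat.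
have Hg f : test_function f ->
    mu.-integrable setT (EFin \o (fun y => g y * f y)) /\ \int[mu]_y (g y * f y) = 0.
  move=> tf; have cf := test_function_continuous tf; have sf := test_function_supported tf.
  have i_ i : mu.-integrable setT (EFin \o (fun y => correlation (a i) (b i) y * f y)).
    by have [] := integral_correlation hA hV (pa i) (pb i) cf sf.
  have E : (fun y => g y * f y) = fun y => \sum_i correlation (a i) (b i) y * f y.
    by apply/funext => y; rewrite /g mulr_suml.
  rewrite E; split; last by rewrite Rintegral_sum// H.
  rewrite (_ : _ \o _ = fun x => (\sum_i (correlation (a i) (b i) x * f x)%:E)%E).
    by apply: integrable_sum => // i _; exact: i_.
  by apply/funext => x; rewrite /= sumEFin.
apply/eqP; rewrite -[X in X == 0]/(g 0); apply: contraT => g0.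
have n0 : 0 < `|g 0| by rewrite normr_gt0.
have n20 : 0 < `|g 0| / 2 by lra.
have [D D0 HD] := cg _ n20.
have tb := smooth_bump_test_function (d := d) D0.
have [ib b0] := Hg _ tb.
have kb := continuous_integrable (test_function_continuous tb) (test_function_supported tb).
have b1 := smooth_bump_integral_gt0 D0.
(* [g 0 * g y >= g 0 ^+ 2 / 2] on the support of the bump *)
have kb2 : mu.-integrable setT (EFin \o (fun y => (g 0 ^+ 2 / 2) * smooth_bump D y)).
  rewrite (_ : _ \o _ = (fun y => ((g 0 ^+ 2) / 2)%:E * (smooth_bump D y)%:E)%E) => [|//].
  exact: integrableZl.
have gb2 : mu.-integrable setT (EFin \o (fun y => g 0 * (g y * smooth_bump D y))).
  rewrite (_ : _ \o _ = (fun y => (g 0)%:E * (g y * smooth_bump D y)%:E)%E) => [|//].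
  exact: integrableZl.
have : \int[mu]_y ((g 0 ^+ 2 / 2) * smooth_bump D y) <= \int[mu]_y (g 0 * (g y * smooth_bump D y)).
  apply: le_Rintegral => // y _; rewrite mulrA.
  have [yD|yD] := ltP `|y| D; last by rewrite smooth_bump_eq0// !mulr0.
  apply: ler_wpM2r; first exact: smooth_bump_ge0.
  have := HD y yD; rewrite -(real_normK (num_real (g 0))).
  have [p|p] := leP 0 (g 0).
    rewrite (ger0_norm p) ler_norml => /andP[lo _].
    have : 0 <= g 0 * (g y - g 0 / 2) by rewrite mulr_ge0//; lra.
    by nra.
  rewrite (ltr0_norm p) ler_norml => /andP[_ hi].
  have : 0 <= - g 0 * (g 0 / 2 - g y) by rewrite mulr_ge0//; lra.
  by nra.
rewrite !RintegralZl// b0 mulr0 => /(lt_le_trans _) - /(_ 0); rewrite ltxx => -> //.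
by rewrite mulr_gt0// divr_gt0// exprn_even_gt0.
Qed.

End correlations.

(** * The Hill-Mandel lemma *)

Section hill_mandel.
Context {R : realType} {d : nat} (A : 'M[R]_d) (hA : A \in unitmx).
Context (V : set 'rV[R]_d) (hV : unit_cell A V).
Local Notation X := 'rV[R]_d.
Local Notation mu := (lebesgue_rV (R := R) (n := d)).
Local Notation field := (X -> 'M[R]_d).
Let mV : measurable V := unit_cell_measurable hV.

Lemma tensor_field_L2per (e : field) i j : tensor_field A e ->
  L2per A (fun x => e x i j).
Proof. by move=> [_ [pe Le]]; split=> // r lr x; rewrite pe. Qed.

Let test_translation (f : X -> R) (x : X) : test_function f ->
  test_function (fun z : X => f (- x + 1 *: z)).
Proof. by move=> tf; apply: test_function_affine => //; exact: oner_neq0. Qed.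

Let test_reflection (f : X -> R) (x : X) : test_function f ->
  test_function (fun z : X => f (x + (-1) *: z)).
Proof. by move=> tf; apply: test_function_affine => //; rewrite oppr_eq0 oner_neq0. Qed.

Let L2loc_test_integrable (b f : X -> R) : L2loc b -> test_function f ->
  mu.-integrable setT (EFin \o (fun x => b x * f x)).
Proof.
move=> Lb tf; apply: L2loc_integrable => //; first exact: test_function_continuous.
exact: test_function_supported.
Qed.

Let continuous_reflection (g : X -> R) (c : X) : continuous g ->
  continuous (fun z : X => g (c - z)).
Proof.
move=> cg z; apply: (@continuous_comp _ _ _ (fun y : X => c - y)); last exact: cg.
apply: (@continuousB _ _ _ (cst c) id); first exact: cst_continuous.
by move=> ?; exact: cvg_id.
Qed.

Let supported_reflection (g : X -> R) (c : X) : compactly_supported g ->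
  compactly_supported (fun z : X => g (c - z)).
Proof.
move=> [r r0 gr]; exists (r + `|c|) => [|z]; first by rewrite addr_ge0.
rewrite -ltrBrDr => rz; apply: gr; apply: (lt_le_trans rz).
by rewrite distrC lerB_dist.
Qed.

(** Integrating by parts brings in the weak gradient of [w].  Contracted with
    the symmetric [s], it has the same value as its symmetric part [h]. *)
Lemma weak_strain_integral (h : field) (w : X -> 'rV[R]_d) (Dw : field)
    (s : 'M[R]_d) (f : X -> R) :
  (forall i j, L2loc (fun x => Dw x i j)) ->
  (forall i j, weak_partial j (fun x => w x ord0 i) (fun x => Dw x i j)) ->
  {ae mu, forall x, h x = 2^-1 *: (Dw x + (Dw x)^T)} ->
  (forall i j, L2loc (fun x => h x i j)) -> symmetric_mx s -> test_function f ->
  \sum_i \sum_j s i j * \int[mu]_z (w z ord0 i * partial j f z) =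
  - \sum_i \sum_j s i j * \int[mu]_z (h z i j * f z).
Proof.
move=> LD wD hD Lh ss tf.
have hE i j : \int[mu]_z (h z i j * f z) =
    2^-1 * (\int[mu]_z (Dw z i j * f z) + \int[mu]_z (Dw z j i * f z)).
  have iD k l := L2loc_test_integrable (LD k l) tf.
  rewrite -RintegralD// -RintegralZl//; last first.
    rewrite (_ : _ \o _ = (EFin \o (fun z => Dw z i j * f z)%R) \+
        (EFin \o (fun z => Dw z j i * f z)%R))%E => [|//].
    exact: integrableD.
  congr fine; apply: ae_eq_integral => //.
  - exact: measurable_int (L2loc_test_integrable (Lh i j) tf).
  - apply/measurable_EFinP; apply: measurable_funM => //.
    have mf := continuous_rV_measurable (test_function_continuous tf).
    by apply: measurable_funD; apply: measurable_funM => //; exact: (proj1 (LD _ _)).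
  - move: hD; apply: filterS => z hz _ /=; congr EFin.
    by rewrite hz !mxE; ring.
have sE i j : s i j = s j i by have /matrixP/(_ j i) := ss; rewrite mxE.
under eq_bigr do under eq_bigr do rewrite wD// mulrN.
rewrite -[LHS]opprK; congr (- _); rewrite -sumrN.
under eq_bigr do rewrite -sumrN; under eq_bigr do under eq_bigr do rewrite opprK.
under [RHS]eq_bigr do under eq_bigr do rewrite hE mulrCA mulrDr.
set D := \sum_i _; pose D' := \sum_i \sum_j s i j * \int[mu]_z (Dw z j i * f z).
have D'E : D' = D.
  rewrite /D' exchange_big /=; apply: eq_bigr => i _; apply: eq_bigr => j _.
  by rewrite sE.
under eq_bigr do rewrite -mulr_sumr big_split/=.
rewrite -mulr_sumr big_split/= -/D -/D' D'E; by field.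
Qed.

(** Reflecting [y] exchanges the two factors of the correlation.  By Fubini the
    sum becomes, up to sign, an integral over [x] of [w x] times the
    divergence of [s] tested against [f (x - .)]. *)
Lemma div_free_correlation (s : field) (w : X -> 'rV[R]_d) (f : X -> R) i :
  self_equilibrated A s -> L2per A (fun x => w x ord0 i) -> test_function f ->
  \sum_j \int[mu]_y (correlation V (fun x => s x i j) (fun x => w x ord0 i) y
                      * partial j f y) = 0.
Proof.
move=> [ts ds] pw tf; pose k j (y : X) := partial j f (0 - y).
have ps j := tensor_field_L2per i j ts.
have sf := test_function_supported tf.
have cp j := @partial_test_function_continuous _ _ f j tf.
have sp j := @partial_supported _ _ f j sf.
have ck j : continuous (k j) by exact: continuous_reflection.
have sk j : compactly_supported (k j) by exact: supported_reflection.
have E j : \int[mu]_y (correlation V (fun x => s x i j) (fun x => w x ord0 i) y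
        * partial j f y) =
    \int[mu]_(x in V) (w x ord0 i * \int[mu]_y (s (x + y) i j * k j y)).
  have [i1 _ _] := integral_correlation hA hV (ps j) pw (cp j) (sp j).
  have [_ _ ->] := integral_correlation hA hV pw (ps j) (ck j) (sk j).
  have m1 := measurable_int _ i1; move/measurable_EFinP in m1.
  rewrite -(Rintegral_reflection 0 m1).
  by apply: eq_Rintegral => y _; rewrite /k sub0r (correlationN hA hV).
under eq_bigr do rewrite E; rewrite -Rintegral_sum//; last first.
  by move=> j; have [] := integral_correlation hA hV pw (ps j) (ck j) (sk j).
transitivity (\int[mu]_(x in V) (0 : R)); last by rewrite Rintegral_cst// mul0r.
apply: eq_Rintegral => x _; rewrite -mulr_sumr.
rewrite (_ : \sum_j _ = 0) ?mulr0//.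
have tr := test_reflection x tf.
have := ds i _ tr => /eqP; rewrite Rintegral_sum// => [/eqP Es|j]; last first.
  apply: L2loc_integrable; first exact: (proj1 (ps j)).
    exact: partial_test_function_continuous.
  exact: partial_supported (test_function_supported tr).
apply: (oppr_inj); rewrite oppr0 -[RHS]Es -sumrN; apply: eq_bigr => j _.
have iG := L2loc_integrable (proj1 (ps j)) (@continuous_reflection _ x (cp j))
  (@supported_reflection _ x (sp j)).
have mG := measurable_int _ iG; move/measurable_EFinP in mG.
rewrite /k; transitivity (\int[mu]_z (-1 * (s z i j * partial j f (x - z)))).
  rewrite (RintegralZl (-1) measurableT iG) mulN1r; apply: (congr1 -%R).
  rewrite -[RHS](Rintegral_translation x mG); apply: eq_Rintegral => y _.
  by rewrite [x + y]addrC opprD addrCA subrr addr0 sub0r.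
apply: eq_Rintegral => z _.
by rewrite partial_affine// scaleN1r mulrCA.
Qed.

(** The correlation of [s] and [h] integrates to zero against every test
    function, so its value at 0 vanishes. *)
Lemma hill_mandel (s h : field) : self_equilibrated A s -> compatible A h ->
  \int[mu]_(x in V) ddot (s x) (h x) = 0.
Proof.
move=> es [th [w [Dw [pw LDw hD]]]]; have [ts _] := es.
have ps i j := tensor_field_L2per i j ts.
have ph i j := tensor_field_L2per i j th.
have pw' i : L2per A (fun x => w x ord0 i).
  by have [[Lw _] pwi] := pw i; split.
pose S (p : 'I_d * 'I_d) x := s x p.1 p.2.
pose H (p : 'I_d * 'I_d) x := h x p.1 p.2.
have pS p : L2per A (S p) by exact: ps.
have pH p : L2per A (H p) by exact: ph.
have SH0 : \sum_p correlation V (S p) (H p) 0 = 0.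
  apply: (mollifier_eq0 hA hV) => // f tf.
  have cf := test_function_continuous tf; have sf := test_function_supported tf.
  have cp j := @partial_test_function_continuous _ _ f j tf.
  have sp j := @partial_supported _ _ f j sf.
  pose I1 p x := S p x * \int[mu]_y (H p (x + y) * f y).
  pose I2 (p : 'I_d * 'I_d) x := S p x * \int[mu]_y (w (x + y) ord0 p.1 * partial p.2 f y).
  have i1 p : mu.-integrable V (EFin \o I1 p) /\
      \int[mu]_y (correlation V (S p) (H p) y * f y) = \int[mu]_(x in V) I1 p x.
    by have [_ ? ?] := integral_correlation hA hV (pS p) (pH p) cf sf.
  have i2 p : mu.-integrable V (EFin \o I2 p) /\
      \int[mu]_y (correlation V (S p) (fun x => w x ord0 p.1) y * partial p.2 f y) =
      \int[mu]_(x in V) I2 p x.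
    by have [_ ? ?] := integral_correlation hA hV (pS p) (pw' p.1) (cp p.2) (sp p.2).
  rewrite (eq_bigr _ (fun p _ => (i1 p).2)) -Rintegral_sum//; last by move=> p; case: (i1 p).
  transitivity (- \int[mu]_(x in V) \sum_p I2 p x).
    rewrite -mulN1r -RintegralZl//; last first.
      rewrite (_ : _ \o _ = fun x => (\sum_p (I2 p x)%:E)%E).
        by apply: integrable_sum => // p _; case: (i2 p).
      by apply/funext => x; rewrite /= sumEFin.
    apply: eq_Rintegral => x _; rewrite mulN1r.
    have tr := test_translation x tf.
    have := weak_strain_integral (fun i j => (LDw i j).1) (fun i j => (LDw i j).2) hD
      (fun i j => proj1 (ph i j)) (proj1 ts x) tr.
    rewrite !pair_bigA /= => /(congr1 -%R); rewrite opprK => E.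
    transitivity (\sum_p s x p.1 p.2 * \int[mu]_z (h z p.1 p.2 * f (- x + 1 *: z))).
      apply: eq_bigr => p _; congr (_ * _).
      have [[mH _] _] := pH p.
      have mG : measurable_fun setT (fun z : X => h z p.1 p.2 * f (- x + 1 *: z)).
        apply: measurable_funM => //; apply: continuous_rV_measurable.
        exact: test_function_continuous.
      rewrite -(Rintegral_translation x mG); apply: eq_Rintegral => y _.
      by rewrite scale1r [y + x]addrC addKr.
    rewrite -E; apply: (congr1 -%R); apply: eq_bigr => p _; apply: (congr1 ( *%R _)).
    have [[mW _] _] := pw' p.1.
    have mG : measurable_fun setT (fun z : X => w z ord0 p.1 * partial p.2 (fun z => f (- x + 1 *: z)) z).
      apply: measurable_funM => //; apply: continuous_rV_measurable.
      exact: partial_test_function_continuous.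
    rewrite -(Rintegral_translation x mG); apply: eq_Rintegral => y _.
    by rewrite partial_affine// mul1r scale1r [y + x]addrC addKr.
  rewrite Rintegral_sum//; last by move=> p; case: (i2 p).
  rewrite -(eq_bigr _ (fun p _ => (i2 p).2)).
  rewrite -(pair_bigA _ (fun i j => \int[mu]_y (correlation V (fun x => s x i j)
     (fun x => w x ord0 i) y * partial j f y)))/=.
  by rewrite big1 ?oppr0// => i _; exact: div_free_correlation.
transitivity (\sum_p \int[mu]_(x in V) (S p x * H p (x + 0))); last exact: SH0.
rewrite -Rintegral_sum//; last first.
  by move=> p; exact: (cell_product_integrable hA hV).
by apply: eq_Rintegral => x _; rewrite /ddot pair_bigA; apply: eq_bigr => p _; rewrite addr0.
Qed.

End hill_mandel.

(** * Linear structure of the spaces of fields *)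

Section L2loc_closure.
Context {R : realType} {d : nat}.
Local Notation X := 'rV[R]_d.
Local Notation mu := (lebesgue_rV (R := R) (n := d)).

Lemma L2loc_le (f g : X -> R) : measurable_fun setT f ->
  {ae mu, forall x, `|f x| <= `|g x|} -> L2loc g -> L2loc f.
Proof.
move=> mf fg [mg goo]; split=> // r; apply: le_lt_trans (goo r).
apply: ae_ge0_le_integral.
- exact: measurable_cube.
- by move=> x _; rewrite lee_fin sqr_ge0.
- by apply: measurable_funS (measurable_sq mf).
- by move=> x _; rewrite lee_fin sqr_ge0.
- by apply: measurable_funS (measurable_sq mg).
move: fg; apply: filterS => x fgx _; rewrite lee_fin.
rewrite -(real_normK (num_real (f x))) -(real_normK (num_real (g x))).
by rewrite lerXn2r ?nnegrE.
Qed.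

Lemma L2locZ (a : R) (f : X -> R) : L2loc f -> L2loc (fun x => a * f x).
Proof.
move=> [mf foo]; split=> [|r]; first exact: measurable_funM.
under eq_integral do rewrite exprMn EFinM.
rewrite ge0_integralZl//.
- by rewrite lte_mul_pinfty// lee_fin sqr_ge0.
- exact: measurable_cube.
- by apply: measurable_funS (measurable_sq mf).
- by move=> x _; rewrite lee_fin sqr_ge0.
- by rewrite lee_fin sqr_ge0.
Qed.

Lemma L2locD (f g : X -> R) : L2loc f -> L2loc g -> L2loc (fun x => f x + g x).
Proof.
move=> [mf foo] [mg goo]; split=> [|r]; first exact: measurable_funD.
have mQ := @measurable_cube R d r.
have mf2 : measurable_fun [set x : X | `|x| <= r] (fun x => ((f x) ^+ 2)%:E).
  by apply: measurable_funS (measurable_sq mf).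
have mg2 : measurable_fun [set x : X | `|x| <= r] (fun x => ((g x) ^+ 2)%:E).
  by apply: measurable_funS (measurable_sq mg).
apply: (@le_lt_trans _ _ (\int[mu]_(x in [set x : X | (`|x| <= r)%R])
    (2%:E * (((f x) ^+ 2)%:E + ((g x) ^+ 2)%:E)))%E).
  apply: ge0_le_integral => //.
  - by move=> x _; rewrite lee_fin sqr_ge0.
  - by apply: measurable_funS (measurable_sq (measurable_funD mf mg)).
  - by apply: measurable_funeM; exact: emeasurable_funD.
  - move=> x _; rewrite -EFinD -EFinM lee_fin.
    have := sqr_ge0 (f x - g x); nra.
rewrite ge0_integralZl//; first last.
- by move=> x _; rewrite -EFinD lee_fin addr_ge0// sqr_ge0.
- exact: emeasurable_funD.
rewrite lte_mul_pinfty// ge0_integralD//; try by move=> x _; rewrite lee_fin sqr_ge0.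
by rewrite lte_add_pinfty.
Qed.

Lemma L2loc_cst (c : R) : L2loc (fun _ : X => c).
Proof.
split=> // r; rewrite integral_cst; last exact: measurable_cube.
by rewrite lte_mul_pinfty// ?lee_fin ?sqr_ge0// lebesgue_rV_cube_lty.
Qed.

Lemma L2loc_sum (I : Type) (s : seq I) (f : I -> X -> R) :
  (forall i, L2loc (f i)) -> L2loc (fun x => \sum_(i <- s) f i x).
Proof.
move=> Lf; elim: s => [|i s IHs].
  by under eq_fun do rewrite big_nil; exact: L2loc_cst.
by under eq_fun do rewrite big_cons; exact: L2locD.
Qed.

Lemma L2loc_bounded (c f : X -> R) (M : R) : measurable_fun setT c ->
  {ae mu, forall x, `|c x| <= M} -> L2loc f -> L2loc (fun x => c x * f x).
Proof.
move=> mc cM Lf; apply: L2loc_le (L2locZ M Lf).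
  by apply: measurable_funM => //; case: Lf.
move: cM; apply: filterS => x cMx; rewrite !normrM ler_wpM2r//.
exact: le_trans cMx (ler_norm M).
Qed.

Lemma weak_partialD j (w w' g g' : X -> R) :
  L2loc w -> L2loc w' -> L2loc g -> L2loc g' ->
  weak_partial j w g -> weak_partial j w' g' ->
  weak_partial j (fun x => w x + w' x) (fun x => g x + g' x).
Proof.
move=> Lw Lw' Lg Lg' wg wg' f tf.
have cf := test_function_continuous tf; have sf := test_function_supported tf.
have cp := @partial_test_function_continuous _ _ f j tf.
have sp := @partial_supported _ _ f j sf.
have i1 := L2loc_integrable Lw cp sp; have i2 := L2loc_integrable Lw' cp sp.
have i3 := L2loc_integrable Lg cf sf; have i4 := L2loc_integrable Lg' cf sf.
under eq_Rintegral do rewrite mulrDl.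
under [in RHS]eq_Rintegral do rewrite mulrDl.
rewrite (RintegralD measurableT i1 i2) (RintegralD measurableT i3 i4).
by rewrite wg// wg'// opprD.
Qed.

Lemma weak_partialZ j (a : R) (w g : X -> R) :
  L2loc w -> L2loc g -> weak_partial j w g ->
  weak_partial j (fun x => a * w x) (fun x => a * g x).
Proof.
move=> Lw Lg wg f tf.
have cf := test_function_continuous tf; have sf := test_function_supported tf.
have cp := @partial_test_function_continuous _ _ f j tf.
have sp := @partial_supported _ _ f j sf.
have i1 := L2loc_integrable Lw cp sp; have i3 := L2loc_integrable Lg cf sf.
under eq_Rintegral do rewrite -mulrA.
under [in RHS]eq_Rintegral do rewrite -mulrA.
by rewrite (RintegralZl a measurableT i1) (RintegralZl a measurableT i3) wg// mulrN.
Qed.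

End L2loc_closure.

Section fields.
Context {R : realType} {d : nat} (A : 'M[R]_d).
Local Notation X := 'rV[R]_d.
Local Notation mu := (lebesgue_rV (R := R) (n := d)).
Local Notation field := (X -> 'M[R]_d).

Lemma tensor_fieldD (e h : field) :
  tensor_field A e -> tensor_field A h -> tensor_field A (e + h).
Proof.
move=> [se [pe Le]] [sh [ph Lh]]; split; [|split].
- by move=> x; rewrite /symmetric_mx /= linearD /= se sh.
- by move=> r lr x; rewrite !addrfctE (pe _ lr) (ph _ lr).
- move=> i j; rewrite (_ : (fun x => _) = fun x => e x i j + h x i j).
    exact: L2locD.
  by apply/funext => x; rewrite mxE.
Qed.

Lemma tensor_fieldZ (a : R) (e : field) :
  tensor_field A e -> tensor_field A (a *: e).
Proof.
move=> [se [pe Le]]; split; [|split].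
- by move=> x; rewrite /symmetric_mx /= linearZ /= se.
- by move=> r lr x; rewrite !scalrfctE (pe _ lr).
- move=> i j; rewrite (_ : (fun x => _) = fun x => a * e x i j).
    exact: L2locZ.
  by apply/funext => x; rewrite mxE.
Qed.

Lemma tensor_field_uniform (e : field) : uniform_field e -> tensor_field A e.
Proof.
by move=> [E sE ->]; split; [|split] => // i j; exact: L2loc_cst.
Qed.

(** Minor symmetry makes the result symmetric, and bounded coefficients keep it
    square integrable. *)
Lemma tensor_field_apply (C : X -> tensor4 R d) (e : field) :
  (forall x, minor_symmetric (C x)) -> lattice_periodic A C ->
  (forall i j k l, measurable_fun setT (fun x => C x i j k l) /\
     exists M, {ae mu, forall x, `|C x i j k l| <= M}) ->
  tensor_field A e -> tensor_field A (apply_tensor C e).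
Proof.
move=> mC pC bC [se [pe Le]]; split; [|split].
- move=> x; apply/matrixP => i j; rewrite !mxE.
  by apply: eq_bigr => k _; apply: eq_bigr => l _; have [-> _] := mC x j i k l.
- by move=> r lr x; rewrite /apply_tensor pC// pe.
- move=> i j; rewrite (_ : (fun x => _) =
      fun x => \sum_k \sum_l C x i j k l * e x k l).
    apply: L2loc_sum => k; apply: L2loc_sum => l.
    by have [mCi [M CM]] := bC i j k l; exact: L2loc_bounded CM (Le k l).
  by apply/funext => x; rewrite mxE.
Qed.

Lemma elasticity_tensor_field (L : X -> tensor4 R d) (e : field) :
  elasticity_field A L -> tensor_field A e -> tensor_field A (apply_tensor L e).
Proof. by move=> [sL pL bL _]; apply: tensor_field_apply => // x; case: (sL x). Qed.

Lemma reference_tensor_field (L0 : tensor4 R d) (e : field) :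
  reference_tensor L0 -> tensor_field A e -> tensor_field A (apply_tensor (cst L0) e).
Proof.
move=> [_ sL0 _]; apply: tensor_field_apply => // i j k l; split=> //.
by exists `|L0 i j k l|; exact: nearW.
Qed.

Lemma H1perD (w w' : X -> R) : H1per A w -> H1per A w' ->
  H1per A (fun x => w x + w' x).
Proof.
move=> [[Lw Dw] pw] [[Lw' Dw'] pw']; split; last first.
  by move=> r lr x; rewrite pw// pw'.
split=> [|i]; first exact: L2locD.
have [g Lg wg] := Dw i; have [g' Lg' wg'] := Dw' i.
by exists (fun x => g x + g' x); [exact: L2locD|exact: weak_partialD].
Qed.

Lemma H1perZ (a : R) (w : X -> R) : H1per A w -> H1per A (fun x => a * w x).
Proof.
move=> [[Lw Dw] pw]; split; last by move=> r lr x; rewrite pw.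
split=> [|i]; first exact: L2locZ.
have [g Lg wg] := Dw i.
by exists (fun x => a * g x); [exact: L2locZ|exact: weak_partialZ].
Qed.

Lemma compatibleD (e h : field) :
  compatible A e -> compatible A h -> compatible A (e + h).
Proof.
move=> [te [w [Dw [pw LD eE]]]] [th [v [Dv [pv LDv hE]]]].
split; first exact: tensor_fieldD.
exists (w + v), (Dw + Dv); split.
- move=> i; rewrite (_ : (fun x => _) = fun x => w x ord0 i + v x ord0 i).
    exact: H1perD.
  by apply/funext => x; rewrite mxE.
- move=> i j; have [L1 W1] := LD i j; have [L2 W2] := LDv i j.
  rewrite (_ : (fun x => (Dw + Dv) x i j) = fun x => Dw x i j + Dv x i j); last first.
    by apply/funext => x; rewrite mxE.
  rewrite (_ : (fun x => (w + v) x ord0 i) = fun x => w x ord0 i + v x ord0 i); last first.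
    by apply/funext => x; rewrite mxE.
  split; first exact: L2locD.
  by apply: weak_partialD => //; [case: (pw i) => -[]|case: (pv i) => -[]].
- move: eE hE; apply: filterS2 => x ex hx.
  by rewrite !addrfctE ex hx -scalerDr addrACA -[(Dw x)^T + _]raddfD.
Qed.

Lemma compatibleZ (a : R) (e : field) : compatible A e -> compatible A (a *: e).
Proof.
move=> [te [w [Dw [pw LD eE]]]]; split; first exact: tensor_fieldZ.
exists (a *: w), (a *: Dw); split.
- move=> i; rewrite (_ : (fun x => _) = fun x => a * w x ord0 i).
    exact: H1perZ.
  by apply/funext => x; rewrite mxE.
- move=> i j; have [L1 W1] := LD i j.
  rewrite (_ : (fun x => (a *: Dw) x i j) = fun x => a * Dw x i j); last first.
    by apply/funext => x; rewrite mxE.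
  rewrite (_ : (fun x => (a *: w) x ord0 i) = fun x => a * w x ord0 i); last first.
    by apply/funext => x; rewrite mxE.
  split; first exact: L2locZ.
  by apply: weak_partialZ => //; case: (pw i) => -[].
- move: eE; apply: filterS => x ex.
  by rewrite !scalrfctE ex scalerA mulrC -scalerA scalerDr -[a *: _^T]linearZ.
Qed.

End fields.

(** * Pairing of stresses and strains *)

Section tensor_algebra.
Context {R : realType} {d : nat}.
Implicit Types (a b e : 'M[R]_d) (C : tensor4 R d).

Lemma ddotDl a b e : ddot (a + b) e = ddot a e + ddot b e.
Proof.
rewrite /ddot -big_split; apply: eq_bigr => i _; rewrite -big_split.
by apply: eq_bigr => j _; rewrite mxE mulrDl.
Qed.

Lemma ddotDr a b e : ddot e (a + b) = ddot e a + ddot e b.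
Proof.
rewrite /ddot -big_split; apply: eq_bigr => i _; rewrite -big_split.
by apply: eq_bigr => j _; rewrite mxE mulrDr.
Qed.

Lemma ddotZl (c : R) a e : ddot (c *: a) e = c * ddot a e.
Proof.
rewrite /ddot mulr_sumr; apply: eq_bigr => i _; rewrite mulr_sumr.
by apply: eq_bigr => j _; rewrite mxE mulrA.
Qed.

Lemma ddotZr (c : R) a e : ddot e (c *: a) = c * ddot e a.
Proof.
rewrite /ddot mulr_sumr; apply: eq_bigr => i _; rewrite mulr_sumr.
by apply: eq_bigr => j _; rewrite mxE mulrCA.
Qed.

Lemma tappD C a b : tapp C (a + b) = tapp C a + tapp C b.
Proof.
apply/matrixP => i j; rewrite !mxE -big_split; apply: eq_bigr => k _.
by rewrite -big_split; apply: eq_bigr => l _; rewrite mxE mulrDr.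
Qed.

Lemma tappZ C (c : R) a : tapp C (c *: a) = c *: tapp C a.
Proof.
apply/matrixP => i j; rewrite !mxE mulr_sumr; apply: eq_bigr => k _.
by rewrite mulr_sumr; apply: eq_bigr => l _; rewrite mxE mulrCA.
Qed.

Lemma ddot_tapp_sym C a b : major_symmetric C ->
  ddot (tapp C a) b = ddot (tapp C b) a.
Proof.
move=> sC; rewrite /ddot !pair_bigA /=.
under eq_bigr do rewrite mxE pair_bigA mulr_suml.
under [RHS]eq_bigr do rewrite mxE pair_bigA mulr_suml.
rewrite exchange_big; apply: eq_bigr => p _; apply: eq_bigr => q _.
by rewrite sC mulrAC.
Qed.

Lemma ddot_ge0 a : 0 <= ddot a a.
Proof. by apply: sumr_ge0 => i _; apply: sumr_ge0 => j _; rewrite -expr2 sqr_ge0. Qed.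

Lemma ddot_eq0 a : ddot a a = 0 -> a = 0.
Proof.
rewrite /ddot pair_bigA /= => /eqP.
rewrite psumr_eq0 => [/allP a0|p _]; last by rewrite -expr2 sqr_ge0.
apply/matrixP => i j; have := a0 (i, j) (mem_index_enum _).
by rewrite /= -expr2 sqrf_eq0 mxE => /eqP.
Qed.

End tensor_algebra.

Section pairing.
Context {R : realType} {d : nat} (A : 'M[R]_d) (hA : A \in unitmx).
Context (V : set 'rV[R]_d) (hV : unit_cell A V).
Local Notation X := 'rV[R]_d.
Local Notation mu := (lebesgue_rV (R := R) (n := d)).
Local Notation field := (X -> 'M[R]_d).
Implicit Types s e h : field.
Let mV : measurable V := unit_cell_measurable hV.

(** The scalar product of strains is the case [s = L0 e]. *)
Definition mean_pairing s e : R := avg V (fun x => ddot (s x) (e x)).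
Local Notation "<< s ; e >>" := (mean_pairing s e).

Lemma ddot_integrable s e : tensor_field A s -> tensor_field A e ->
  mu.-integrable V (EFin \o (fun x => ddot (s x) (e x))).
Proof.
move=> ts te; rewrite (_ : _ \o _ = (fun x =>
    (\sum_(p : 'I_d * 'I_d) (s x p.1 p.2 * e x p.1 p.2)%:E)%E)).
  apply: integrable_sum => // p _.
  have := cell_product_integrable hA hV 0 (tensor_field_L2per p.1 p.2 ts)
    (tensor_field_L2per p.1 p.2 te).
  by apply: eq_integrable => // x _ /=; rewrite addr0.
by apply/funext => x; rewrite /= /ddot pair_bigA -sumEFin.
Qed.

Lemma mean_pairingDl s s' e : tensor_field A s -> tensor_field A s' ->
  tensor_field A e -> << s + s'; e >> = << s; e >> + << s'; e >>.
Proof.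
move=> ts ts' te; rewrite /mean_pairing /avg -mulrDr; congr (_ * _).
rewrite -(RintegralD mV (ddot_integrable ts te) (ddot_integrable ts' te)).
by apply: eq_Rintegral => x _; rewrite -ddotDl.
Qed.

Lemma mean_pairingDr s e e' : tensor_field A s -> tensor_field A e ->
  tensor_field A e' -> << s; e + e' >> = << s; e >> + << s; e' >>.
Proof.
move=> ts te te'; rewrite /mean_pairing /avg -mulrDr; congr (_ * _).
rewrite -(RintegralD mV (ddot_integrable ts te) (ddot_integrable ts te')).
by apply: eq_Rintegral => x _; rewrite -ddotDr.
Qed.

Lemma mean_pairingZl (c : R) s e : tensor_field A s -> tensor_field A e ->
  << c *: s; e >> = c * << s; e >>.
Proof.
move=> ts te; rewrite /mean_pairing /avg mulrCA; congr (_ * _).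
rewrite -(RintegralZl c mV (ddot_integrable ts te)).
by apply: eq_Rintegral => x _; rewrite -ddotZl.
Qed.

Lemma mean_pairingZr (c : R) s e : tensor_field A s -> tensor_field A e ->
  << s; c *: e >> = c * << s; e >>.
Proof.
move=> ts te; rewrite /mean_pairing /avg mulrCA; congr (_ * _).
rewrite -(RintegralZl c mV (ddot_integrable ts te)).
by apply: eq_Rintegral => x _; rewrite -ddotZr.
Qed.

Lemma mean_pairing_sym (C : X -> tensor4 R d) e h :
  (forall x, major_symmetric (C x)) ->
  << apply_tensor C e; h >> = << apply_tensor C h; e >>.
Proof.
move=> sC; rewrite /mean_pairing /avg; congr (_ * _).
by apply: eq_Rintegral => x _; exact: ddot_tapp_sym.
Qed.

Lemma apply_tensorD (C : X -> tensor4 R d) e h :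
  apply_tensor C (e + h) = apply_tensor C e + apply_tensor C h.
Proof. by apply/funext => x; rewrite /apply_tensor addrfctE tappD. Qed.

Lemma apply_tensorZ (C : X -> tensor4 R d) (c : R) e :
  apply_tensor C (c *: e) = c *: apply_tensor C e.
Proof. by apply/funext => x; rewrite /apply_tensor scalrfctE tappZ. Qed.

Lemma fine_unit_cell_gt0 : 0 < fine (mu V).
Proof. by rewrite fine_gt0// (unit_cell_gt0 hV)/= (unit_cell_lty hA hV). Qed.

(** Coercivity reduces the claim to a mean square, and a periodic field that
    vanishes almost everywhere on a cell vanishes almost everywhere. *)
Lemma elastic_energy_gt0 (L : X -> tensor4 R d) e :
  elasticity_field A L -> tensor_field A e -> ~ ae_zero e ->
  0 < << apply_tensor L e; e >>.
Proof.
move=> hL te e0; have [_ _ _ [c c0 Lc]] := hL.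
have tL := elasticity_tensor_field hL te.
have ie := ddot_integrable te te; have iL := ddot_integrable tL te.
rewrite /mean_pairing /avg mulr_gt0// ?invr_gt0 ?fine_unit_cell_gt0//.
have me : measurable_fun V (EFin \o (fun x => ddot (e x) (e x))) := measurable_int _ ie.
have e2 : (0 < \int[mu]_(x in V) (ddot (e x) (e x))%:E)%E.
  rewrite lt0e integral_ge0 ?andbT => [|x _]; last by rewrite lee_fin ddot_ge0.
  apply/eqP => I0; apply: e0.
  have : (\int[mu]_(x in V) `|(ddot (e x) (e x))%:E| = 0)%E.
    rewrite -[RHS]I0; apply: eq_integral => x _.
    by rewrite gee0_abs// lee_fin ddot_ge0.
  move=> /(ae_eq_integral_abs _ mV me) V0.
  apply: (ae_cell_periodic hV) => [r lr x|].
    by have [_ [pe _]] := te; rewrite pe.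
  move: V0; apply: filterS => x /[apply] /= -[]; exact: ddot_eq0.
have cE : (c%:E * \int[mu]_(x in V) (ddot (e x) (e x))%:E <=
    \int[mu]_(x in V) (ddot (apply_tensor L e x) (e x))%:E)%E.
  have mL : measurable_fun V (EFin \o (fun x => ddot (apply_tensor L e x) (e x))) :=
    measurable_int _ iL.
  (* coercivity holds almost everywhere only; the maximum is a version of the
     energy density that satisfies it at every point *)
  pose M x := Num.max (c * ddot (e x) (e x)) (ddot (apply_tensor L e x) (e x)).
  have mM : measurable_fun V (EFin \o M).
    apply/measurable_EFinP; apply: measurable_maxr; last exact/measurable_EFinP.
    by apply: measurable_funM => //; exact/measurable_EFinP.
  rewrite -(integralZl mV ie) (@ae_eq_integral _ _ _ mu V (EFin \o M) _ mV mL mM); last first.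
    move: Lc; apply: filterS => x Lcx _; rewrite /= /M max_r// Lcx//.
    by case: te.
  apply: ge0_le_integral => //.
  - by move=> x _; rewrite -EFinM lee_fin mulr_ge0 ?ddot_ge0 ?ltW.
  - exact: measurable_funeM.
  - by move=> x _; rewrite /= -EFinM lee_fin le_max lexx.
rewrite /Rintegral fine_gt0//; apply/andP; split.
  by apply: lt_le_trans cE; rewrite mule_gt0.
by rewrite -ge0_fin_numE ?integrable_fin_num//; apply: le_trans cE; rewrite mule_ge0// ?lee_fin ltW.
Qed.

End pairing.

(** * Gradients of the two functionals *)

(** Both functionals restrict to quadratic polynomials on lines. *)
Lemma difference_quotient_cvg (R : realType) (F : R -> R) (a b : R) :
  (forall t, F t - F 0 = t * a + t ^+ 2 * b) ->
  (F t - F 0) / t @[t --> (0 : R)^'] --> a.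
Proof.
move=> FE; have ab : a + t * b @[t --> (0 : R)^'] --> a.
  have nb : (fun t : R => a + t * b) @ nbhs (0 : R) --> a + 0 * b.
    apply: (@continuousD _ _ _ (cst a) (fun t : R => t * b)).
      exact: cst_continuous.
    apply: (@continuousM _ _ id (cst b)); last exact: cst_continuous.
    by move=> ?; exact: cvg_id.
  rewrite mul0r addr0 in nb; exact: cvg_within_filter nb.
apply: cvg_trans ab; apply: near_eq_cvg; near=> t.
have t0 : t != 0 by near: t; exact: nbhs_dnbhs_neq.
by rewrite FE; field.
Unshelve. all: by end_near. Qed.

Section gradients.
Context {R : realType} {d : nat} (A : 'M[R]_d) (hA : A \in unitmx).
Context (V : set 'rV[R]_d) (hV : unit_cell A V).
Context (L0 : tensor4 R d) (hL0 : reference_tensor L0).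
Context (L : 'rV[R]_d -> tensor4 R d) (hL : elasticity_field A L).
Local Notation X := 'rV[R]_d.
Local Notation field := (X -> 'M[R]_d).
Context (Gamma0 : field -> field) (hGamma0 : strain_green A L0 Gamma0).
Context (ebar : field) (hebar : uniform_field ebar).
Implicit Types (e g h : field).
Local Notation pairing := (mean_pairing V).
Local Notation inner := (inner_e V L0).
Local Notation J := (energetic_functional V L ebar).
Local Notation N := (geometric_functional A V L0 L ebar).
Local Notation grad := (gradient A V L0).

Let compatible_tensor e : compatible A e -> tensor_field A e. Proof. by case. Qed.

Let L0_tensor e : tensor_field A e -> tensor_field A (apply_tensor (cst L0) e).
Proof. exact: reference_tensor_field. Qed.

Let L_tensor e : tensor_field A e -> tensor_field A (apply_tensor L e).
Proof. exact: elasticity_tensor_field. Qed.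

Lemma inner_e_sym e h : inner e h = inner h e.
Proof. by apply: (mean_pairing_sym V (C := cst L0)) => x; case: hL0. Qed.

Lemma elastic_pairing_sym e h :
  pairing (apply_tensor L e) h = pairing (apply_tensor L h) e.
Proof. by apply: mean_pairing_sym => x; case: hL => /(_ x)[]. Qed.

Lemma inner_eZl (c : R) e h : tensor_field A e -> tensor_field A h ->
  inner (c *: e) h = c * inner e h.
Proof.
move=> te th; rewrite /inner_e apply_tensorZ.
by apply: (mean_pairingZl hA hV) => //; exact: L0_tensor.
Qed.

Lemma inner_e_ge0 e : tensor_field A e -> 0 <= inner e e.
Proof.
move=> [se _]; apply: mulr_ge0; first by rewrite invr_ge0 fine_ge0.
apply: Rintegral_ge0 => x _; have [_ _ L0p] := hL0.
have [->|ex0] := eqVneq (e x) 0; last exact/ltW/L0p.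
rewrite /ddot big1// => i _; rewrite big1// => j _; by rewrite [X in _ * X]mxE mulr0.
Qed.

Lemma norm_e_sq e : tensor_field A e -> norm_e V L0 e ^+ 2 = inner e e.
Proof. by move=> te; rewrite sqr_sqrtr// inner_e_ge0. Qed.

(** The difference [L0 (Gamma0 t) - t] is self-equilibrated, hence orthogonal to
    [h] by the Hill-Mandel lemma. *)
Lemma strain_green_dual t h : tensor_field A t -> compatible A h ->
  inner (Gamma0 t) h = pairing t h.
Proof.
move=> tt ch; have [cG sG] := hGamma0 tt; have th := compatible_tensor ch.
have tG := L0_tensor (compatible_tensor cG).
have := hill_mandel hA hV sG ch => H.
have tNt := tensor_fieldZ (-1) tt.
have : pairing (apply_tensor (cst L0) (Gamma0 t) - t) h = 0.
  by rewrite /mean_pairing /avg H mulr0.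
rewrite -scaleN1r (mean_pairingDl hA hV)// (mean_pairingZl hA hV)// mulN1r.
by move/eqP; rewrite subr_eq0 => /eqP.
Qed.

Let ebar_tensor e : compatible A e -> tensor_field A (ebar + e).
Proof.
by move=> ce; apply: tensor_fieldD; [exact: tensor_field_uniform|exact: compatible_tensor].
Qed.

Definition is_gateaux (F : field -> R) e (D : field -> R) :=
  forall h, compatible A h -> (F (e + t *: h) - F e) / t @[t --> (0 : R)^'] --> D h.

(** A representative [g] of the derivative shows that a gradient exists; the
    chosen gradient may be another one, but uniqueness of limits gives it the
    same products with compatible fields. *)
Lemma gradient_gateaux (F : field -> R) e (D : field -> R) g : is_gateaux F e D ->
  compatible A g -> (forall h, compatible A h -> inner g h = D h) ->
  is_gradient A V L0 F e (grad F e) /\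
  (forall h, compatible A h -> inner (grad F e) h = D h).
Proof.
move=> FD cg gD; have gG : is_gradient A V L0 F e g.
  by split=> // h ch; rewrite gD//; exact: FD.
have GG : is_gradient A V L0 F e (grad F e) by apply: xgetPex; exists g.
split=> // h ch; exact: (cvg_unique (@Rhausdorff R) (GG.2 h ch) (FD h ch)).
Qed.

Lemma energetic_gateaux e : compatible A e ->
  is_gateaux J e (fun h => pairing (apply_tensor L (ebar + e)) h).
Proof.
move=> ce h ch; have te := ebar_tensor ce; have th := compatible_tensor ch.
have JE v : J v = 2^-1 * pairing (apply_tensor L (ebar + v)) (ebar + v) by [].
have := @difference_quotient_cvg R (fun t => J (e + t *: h))
  (pairing (apply_tensor L (ebar + e)) h) (2^-1 * pairing (apply_tensor L h) h).
rewrite /= scale0r addr0; apply=> t; rewrite !JE [ebar + (e + _)]addrA.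
move: (ebar + e) te => u te.
have tt := tensor_fieldZ t th.
rewrite (apply_tensorD L u) apply_tensorZ.
have tLe := L_tensor te; have tLh := L_tensor th; have tLt := tensor_fieldZ t tLh.
rewrite (mean_pairingDl hA hV)//; last exact: tensor_fieldD.
rewrite !(mean_pairingDr hA hV)//. rewrite !(mean_pairingZl hA hV)// !(mean_pairingZr hA hV)//.
by rewrite (elastic_pairing_sym h u); field.
Qed.

Lemma gradient_energetic e : compatible A e ->
  is_gradient A V L0 J e (grad J e) /\
  (forall h, compatible A h ->
     inner (grad J e) h = pairing (apply_tensor L (ebar + e)) h).
Proof.
move=> ce; have tL := L_tensor (ebar_tensor ce); have [cG _] := hGamma0 tL.
by apply: (gradient_gateaux (energetic_gateaux ce) cG) => h ch; exact: strain_green_dual.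
Qed.

Let gradJ_compatible e : compatible A e -> compatible A (grad J e).
Proof. by move=> /gradient_energetic[[]]. Qed.

(** The gradient of [J] is affine in [e], up to equality almost everywhere. *)
Lemma gradient_energetic_increment e h t : compatible A e -> compatible A h ->
  forall k, compatible A k ->
  inner (grad J (e + t *: h)) k =
  inner (grad J e) k + t * inner (Gamma0 (apply_tensor L h)) k.
Proof.
move=> ce ch k ck; have th := compatible_tensor ch; have te := ebar_tensor ce.
have cet : compatible A (e + t *: h).
  by apply: compatibleD => //; exact: compatibleZ.
have [_ /(_ k ck)] := gradient_energetic cet.
have [_ /(_ k ck)] := gradient_energetic ce.
move: (grad J e) (grad J (e + t *: h)) => g0 gt -> ->.
rewrite strain_green_dual//; last exact: L_tensor.
have tt := tensor_fieldZ t th; have tk := compatible_tensor ck.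
have tLe := L_tensor te; have tLh := L_tensor th; have tLt := tensor_fieldZ t tLh.
by rewrite addrA (apply_tensorD L (ebar + e)) apply_tensorZ (mean_pairingDl hA hV)// (mean_pairingZl hA hV).
Qed.

(** Expanding the square of [grad J e + t *: Gamma0 (L h)], the linear term is
    [t * (grad J e, Gamma0 (L h))], which is [t * <L h : grad J e>]. *)
Lemma geometric_gateaux e : compatible A e ->
  is_gateaux N e (fun h => pairing (apply_tensor L (grad J e)) h).
Proof.
move=> ce h ch; have th := compatible_tensor ch.
have NE u : compatible A u -> N u = 2^-1 * inner (grad J u) (grad J u).
  by move=> cu; rewrite /geometric_functional norm_e_sq//; exact/compatible_tensor/gradJ_compatible.
have cet t : compatible A (e + t *: h).
  by apply: compatibleD => //; exact: compatibleZ.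
pose G := Gamma0 (apply_tensor L h).
have cG : compatible A G by have [] := hGamma0 (L_tensor th).
have dG k : compatible A k -> inner G k = pairing (apply_tensor L h) k.
  exact: strain_green_dual (L_tensor th).
have := @difference_quotient_cvg R (fun t => N (e + t *: h))
  (pairing (apply_tensor L (grad J e)) h) (2^-1 * inner G G).
rewrite /= scale0r addr0; apply=> t.
rewrite (NE _ (cet t)) (NE _ ce).
move: (gradient_energetic_increment t ce ch) (gradJ_compatible (cet t)).
move: (gradJ_compatible ce); rewrite -/G; clearbody G.
move: (grad J e) (grad J (e + t *: h)) => g0 gt cg0 inc cgt.
rewrite (inc _ cgt) (inner_e_sym g0 gt) (inc _ cg0).
rewrite (inner_e_sym G gt) (inc _ cG) (inner_e_sym g0 G).
by rewrite (dG _ cg0) (elastic_pairing_sym h g0); field.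
Qed.

Lemma gradient_geometric e : compatible A e ->
  is_gradient A V L0 N e (grad N e) /\
  (forall h, compatible A h ->
     inner (grad N e) h = pairing (apply_tensor L (grad J e)) h).
Proof.
move=> ce; have tL := L_tensor (compatible_tensor (gradJ_compatible ce)).
have [cG _] := hGamma0 tL.
by apply: (gradient_gateaux (geometric_gateaux ce) cG) => h ch; exact: strain_green_dual.
Qed.

Lemma gradient_pairing_gt0 e : compatible A e -> ~ ae_zero (grad J e) ->
  0 < inner (grad N e) (grad J e).
Proof.
move=> ce nz; have cJ := gradJ_compatible ce.
rewrite (gradient_geometric ce).2//.
exact: (elastic_energy_gt0 hA hV hL (compatible_tensor cJ) nz).
Qed.

Lemma geometric_functionalE e : compatible A e ->
  N e = 2^-1 * norm_e V L0 (Gamma0 (apply_tensor L (ebar + e))) ^+ 2.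
Proof.
move=> ce; have tL := L_tensor (ebar_tensor ce); have [cG _] := hGamma0 tL.
have dG k : compatible A k ->
    inner (Gamma0 (apply_tensor L (ebar + e))) k = pairing (apply_tensor L (ebar + e)) k.
  exact: strain_green_dual.
have [_ dJ] := gradient_energetic ce.
rewrite /geometric_functional; move: (gradJ_compatible ce) dJ cG dG.
move: (grad J e) (Gamma0 _) => g G cg dg cG dG; apply: (congr1 ( *%R _)).
rewrite (norm_e_sq (compatible_tensor cg)) (norm_e_sq (compatible_tensor cG)).
by rewrite (dg _ cg) -(dG _ cg) (inner_e_sym G g) (dg _ cG) (dG _ cG).
Qed.

Lemma descent_direction_opp (F : field -> R) e p : compatible A p ->
  compatible A (grad F e) -> 0 < inner p (grad F e) ->
  descent_direction A V L0 F e (- p).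
Proof.
rewrite /descent_direction; move: (grad F e) => g cp cg pos.
rewrite -scaleN1r; split; first exact: compatibleZ.
rewrite (inner_eZl (-1) (compatible_tensor cp) (compatible_tensor cg)).
by rewrite mulN1r oppr_lt0.
Qed.

End gradients.

Theorem proposition3 (R : realType) (d : nat) (hd : (0 < d)%N)
    (A : 'M[R]_d) (hA : A \in unitmx)
    (V : set 'rV[R]_d) (hV : unit_cell A V)
    (L0 : tensor4 R d) (hL0 : reference_tensor L0)
    (L : 'rV[R]_d -> tensor4 R d) (hL : elasticity_field A L)
    (Gamma0 : ('rV[R]_d -> 'M[R]_d) -> ('rV[R]_d -> 'M[R]_d))
    (hGamma0 : strain_green A L0 Gamma0)
    (ebar : 'rV[R]_d -> 'M[R]_d) (hebar : uniform_field ebar) :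
  let J := energetic_functional V L ebar in
  let N := geometric_functional A V L0 L ebar in
  let grad := gradient A V L0 in
  forall e : 'rV[R]_d -> 'M[R]_d, compatible A e ->
    [/\ is_gradient A V L0 J e (grad J e),
        is_gradient A V L0 N e (grad N e),
        N e = 2^-1 * norm_e V L0 (Gamma0 (apply_tensor L (ebar + e))) ^+ 2 &
        ~ ae_zero (grad J e) ->
          descent_direction A V L0 J e (- grad N e) /\
          descent_direction A V L0 N e (- grad J e)].
Proof.
move=> J N grad e ce.
have [GJ _] := gradient_energetic hA hV hL0 hL hGamma0 hebar ce.
have [GN _] := gradient_geometric hA hV hL0 hL hGamma0 hebar ce.
split; [exact: GJ|exact: GN| |move=> nz].
  exact: (geometric_functionalE hA hV hL0 hL hGamma0 hebar ce).
have pos := gradient_pairing_gt0 hA hV hL0 hL hGamma0 hebar ce nz.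
split; apply: (descent_direction_opp hA hV hL0).
- exact: (proj1 GN).
- exact: (proj1 GJ).
- exact: pos.
- exact: (proj1 GJ).
- exact: (proj1 GN).
- rewrite (inner_e_sym V hL0); exact: pos.
Qed.
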